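(* The 3-dimensional Riemannian manifolds $Nil_3$, $Sol_3$, $\widetilde{PSL_2(\mathbb{R})}$, the Berger spheres and the tori $\mathbb{T}^3_B$ cannot be isometrically immersed into the Euclidean space $\mathbb{R}^4$, even locally (i.e. no nonempty open subset of any of these manifolds admits an isometric immersion into $\mathbb{R}^4$).
   Context: The manifolds $Nil_3$, $\widetilde{PSL_2(\mathbb{R})}$ and the Berger spheres are the simply connected homogeneous Riemannian 3-manifolds $\mathbb{E}(\kappa,\tau)$ with $\tau\neq0$, $\kappa\neq4\tau^2$, with respectively $\kappa=0$, $\kappa<0$, $\kappa>0$. $\mathbb{E}(\kappa,\tau)$ is a Riemannian fibration over the simply connected surface of constant curvature $\kappa$ with bundle curvature $\tau$; it has local direct orthonormal frames $\{e_1,e_2,e_3=\xi\}$, where $\xi$ is the unit Killing field tangent to the fibers, whose Christoffel symbols $\Gamma_{ij}^k=\langle\nabla_{e_i}e_j,e_k\rangle$ are $\Gamma_{12}^3=\Gamma_{23}^1=-\Gamma_{21}^3=-\Gamma_{13}^2=\tau$, $\Gamma_{32}^1=-\Gamma_{31}^2=\tau-\frac{\kappa}{2\tau}$, all others zero; equivalently $[e_1,e_2]=2\tau e_3$, $[e_2,e_3]=\frac{\kappa}{2\tau}e_1$, $[e_3,e_1]=\frac{\kappa}{2\tau}e_2$. $Sol_3$ is $\mathbb{R}^3$ with the metric $e^{2z}dx^2+e^{-2z}dy^2+dz^2$. $\mathbb{T}^3_B$: let $B\in SL_2(\mathbb{Z})$ be a matrix with two distinct real eigenvalues $\alpha>0$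 and $\frac1\alpha$, viewed as a diffeomorphism of the flat torus $\mathbb{T}^2$. $\mathbb{T}^3_B$ is the quotient of $\mathbb{T}^2\times\mathbb{R}$ by the equivalence relation generated by $(p,z)\equiv(B(p),z+1)$, with a Riemannian metric whose lift to the universal cover $\mathbb{R}^3$ (coordinates $(x,y,z)$) has orthonormal frame $e_1=\alpha^{-z}v_1$, $e_2=\alpha^{z}v_2$, $e_3=\partial_z$, where $v_1,v_2$ are constant vector fields in the $(x,y)$-plane given by eigenvectors of $B$ for the eigenvalues $\frac1\alpha$ and $\alpha$ respectively. Thus $[e_1,e_2]=0$, $[e_1,e_3]=\ln(\alpha)e_1$, $[e_2,e_3]=-\ln(\alpha)e_2$. *)

(* Defs.v *)
From HB Require Import structures.
From mathcomp Require Import all_boot all_order all_algebra.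
From mathcomp Require Import all_classical all_reals all_analysis.
From Stdlib Require Import Relation_Operators.
Set Implicit Arguments.
Unset Strict Implicit.
Unset Printing Implicit Defensive.
Import Order.TTheory GRing.Theory Num.Theory.
Import numFieldNormedType.Exports.
Local Open Scope classical_set_scope.
Local Open Scope ring_scope.
Local Open Scope quotient_scope.

(* The library norm on 'rV[R]_n is the sup norm: it is used only for topology
   and differentiability, Euclidean geometry goes through [dot]. *)
Definition dot (R : realType) (n : nat) (u v : 'rV[R]_n) : R :=
  \sum_(i < n) u 0 i * v 0 i.

Fixpoint Ck_on (R : realType) (V W : normedModType R) (k : nat) (U : set V)
    (f : V -> W) : Prop :=
  match k with
  | 0 => forall x, U x -> {for x, continuous f}
  | k'.+1 => (forall x, U x -> differentiable f x) /\
             forall v : V, Ck_on k' U (fun x => 'D_v f x)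
  end.

(* Meant for U open; only the germs of f along U matter. *)
Definition smooth_on (R : realType) (V W : normedModType R) (U : set V)
    (f : V -> W) : Prop :=
  forall k, Ck_on k U f.

(* A field of bilinear forms: g p u v is the inner product of u and v at p. *)
Definition metric (R : realType) (n : nat) :=
  'rV[R]_n -> 'rV[R]_n -> 'rV[R]_n -> R.

(* That f is an immersion is automatic, g p being positive definite in all the
   cases considered below. *)
Definition isometric_immersion (R : realType) (n m : nat) (g : metric R n)
    (U : set 'rV[R]_n) (f : 'rV[R]_n -> 'rV[R]_m) : Prop :=
  smooth_on U f /\
  forall p, U p -> forall u v, dot ('d f p u) ('d f p v) = g p u v.

(* Omega is an open subset of R^n, with the Riemannian metric g. *)
Definition locally_immersible (R : realType) (n m : nat) (Omega : set 'rV[R]_n)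
    (g : metric R n) : Prop :=
  exists U : set 'rV[R]_n, [/\ open U, U !=set0, U `<=` Omega &
    exists f : 'rV[R]_n -> 'rV[R]_m, isometric_immersion g U f].

(* The same for a submanifold M of R^n, with tangent space T p at p and metric
   g p on T p. As usual, a map on a relatively open part of M is smooth when it
   extends smoothly to a neighbourhood in R^n of each point, and its
   differential on T p is that of any such extension. *)
Definition sub_isometric_immersion (R : realType) (n m : nat)
    (T : 'rV[R]_n -> set 'rV[R]_n) (g : metric R n)
    (V : set 'rV[R]_n) (f : 'rV[R]_n -> 'rV[R]_m) : Prop :=
  forall p, V p ->
    exists (W : set 'rV[R]_n) (F : 'rV[R]_n -> 'rV[R]_m),
      [/\ open W, W p, smooth_on W F, (forall q, V q -> W q -> F q = f q) &
        forall u v, T p u -> T p v -> dot ('d F p u) ('d F p v) = g p u v].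

Definition sub_locally_immersible (R : realType) (n m : nat)
    (M : set 'rV[R]_n) (T : 'rV[R]_n -> set 'rV[R]_n) (g : metric R n) : Prop :=
  exists U : set 'rV[R]_n, [/\ open U, (U `&` M) !=set0 &
    exists f : 'rV[R]_n -> 'rV[R]_m, sub_isometric_immersion T g (U `&` M) f].

(* For kappa <= 0, E(kappa, tau) is globally the domain [E_domain kappa] of R^3
   with the metric
     lambda^2 (dx^2 + dy^2) + (tau lambda (y dx - x dy) + dz)^2,
   lambda = 1 / (1 + kappa/4 (x^2 + y^2)); the fibration is (x,y,z) |-> (x,y).
   With s = kappa / (2 tau), the frame
     e_1 = cos(sz) E_1 + sin(sz) E_2,  e_2 = - sin(sz) E_1 + cos(sz) E_2,
     e_3 = d_z,
     E_1 = lambda^-1 d_x - tau y d_z,  E_2 = lambda^-1 d_y + tau x d_z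
   is orthonormal and satisfies [e_1,e_2] = 2 tau e_3, [e_2,e_3] = s e_1,
   [e_3,e_1] = s e_2. *)
Definition E_conf (R : realType) (kappa : R) (p : 'rV[R]_3) : R :=
  1 + kappa / 4 * ((p 0 0) ^+ 2 + (p 0 1) ^+ 2).

Definition E_domain (R : realType) (kappa : R) : set 'rV[R]_3 :=
  [set p | 0 < E_conf kappa p].

Definition E_metric (R : realType) (kappa tau : R) : metric R 3 :=
  fun p u v =>
    let lambda := (E_conf kappa p)^-1 in
    let eta w := tau * lambda * (p 0 1 * w 0 0 - p 0 0 * w 0 1) + w 0 2 in
    lambda ^+ 2 * (u 0 0 * v 0 0 + u 0 1 * v 0 1) + eta u * eta v.

(* For kappa > 0, E(kappa, tau) is the unit sphere of C^2 = R^4 with the metric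
   4/kappa (<u,v> + (4 tau^2/kappa - 1) <u,ix> <v,ix>). The Hopf fibration maps
   it to the sphere of curvature kappa, with bundle curvature tau (up to the
   choice of orientation); the unit Killing field is kappa/(4 tau) ix. *)
Definition sphere3 (R : realType) : set 'rV[R]_4 := [set x | dot x x = 1].

Definition sphere3_tangent (R : realType) (x : 'rV[R]_4) : set 'rV[R]_4 :=
  [set u | dot x u = 0].

Definition mul_i (R : realType) (x : 'rV[R]_4) : 'rV[R]_4 :=
  \row_(j < 4) [:: - x 0 1; x 0 0; - x 0 3; x 0 2]`_j.

Definition Berger_metric (R : realType) (kappa tau : R) : metric R 4 :=
  fun x u v => 4 / kappa *
    (dot u v + (4 * tau ^+ 2 / kappa - 1) * dot u (mul_i x) * dot v (mul_i x)).

Definition Sol_metric (R : realType) : metric R 3 :=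
  fun p u v => expR (2 * p 0 2) * (u 0 0 * v 0 0)
             + expR (- (2 * p 0 2)) * (u 0 1 * v 0 1) + u 0 2 * v 0 2.

Section generated_equivalence.
Context {T : choiceType} (r : T -> T -> Prop).

Let gen (x y : T) : bool := `[< clos_refl_sym_trans T r x y >].

Local Lemma gen_refl : reflexive gen.
Proof. by move=> x; apply/asboolP; exact: rst_refl. Qed.

Local Lemma gen_sym : symmetric gen.
Proof. by move=> x y; apply/asboolP/asboolP => h; exact: rst_sym. Qed.

Local Lemma gen_trans : transitive gen.
Proof.
move=> y x z /asboolP xy /asboolP yz; apply/asboolP; exact: rst_trans xy yz.
Qed.

Definition generated_equiv : equiv_rel T := EquivRel gen gen_refl gen_sym gen_trans.

End generated_equivalence.

Definition lattice_rel (R : realType) (p q : 'rV[R]_2) : Prop :=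
  exists m : 'rV[int]_2, q = p + map_mx intr m.

Definition torus2 (R : realType) : Type :=
  {eq_quot generated_equiv (@lattice_rel R)}.
HB.instance Definition _ (R : realType) := Quotient.on (torus2 R).
HB.instance Definition _ (R : realType) :=
  Topological.copy (torus2 R) (quotient_topology (torus2 R)).

(* Points of R^2 are rows: the linear map of R^2 with matrix B is p |-> p B^T. *)
Definition lin_act (R : realType) (B : 'M[int]_2) (p : 'rV[R]_2) : 'rV[R]_2 :=
  p *m (map_mx intr B)^T.

Definition suspension_rel (R : realType) (B : 'M[int]_2)
    (a b : torus2 R * R) : Prop :=
  exists (p : 'rV[R]_2) (z : R),
    a = (\pi_(torus2 R) p, z) /\ b = (\pi_(torus2 R) (lin_act B p), z + 1).

Definition torusB (R : realType) (B : 'M[int]_2) : Type :=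
  {eq_quot generated_equiv (@suspension_rel R B)}.
HB.instance Definition _ (R : realType) (B : 'M[int]_2) :=
  Quotient.on (torusB R B).
HB.instance Definition _ (R : realType) (B : 'M[int]_2) :=
  Topological.copy (torusB R B) (quotient_topology (torusB R B)).

(* The universal covering R^3 -> T^3_B. *)
Definition torusB_cover (R : realType) (B : 'M[int]_2) (p : 'rV[R]_3) :
    torusB R B :=
  \pi_(torusB R B)
    (\pi_(torus2 R) (\row_(j < 2) [:: p 0 0; p 0 1]`_j), p 0 2).

Definition horizontal (R : realType) (v : 'rV[R]_2) : 'rV[R]_3 :=
  \row_(j < 3) [:: v 0 0; v 0 1; 0]`_j.

Definition torusB_frame (R : realType) (alpha : R) (v1 v2 : 'rV[R]_2)
    (p : 'rV[R]_3) (i : 'I_3) : 'rV[R]_3 :=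
  [:: alpha `^ (- p 0 2) *: horizontal v1;
      alpha `^ (p 0 2) *: horizontal v2;
      \row_(j < 3) [:: 0; 0; 1]`_j]`_i.

(* The inner product for which the rows of an invertible matrix A are
   orthonormal: u *m invmx A is the row of coordinates of u in these rows. *)
Definition frame_metric (R : realType) (n : nat)
    (e : 'rV[R]_n -> 'I_n -> 'rV[R]_n) : metric R n :=
  fun p u v =>
    let A := \matrix_(i < n) e p i in dot (u *m invmx A) (v *m invmx A).

(* T^3_B has the smooth structure and the metric for which the covering
   R^3 -> T^3_B is a local isometry, R^3 having the above orthonormal frame:
   a map on an open V is an isometric immersion iff its lift is one. *)
Definition torusB_locally_immersible (R : realType) (m : nat) (B : 'M[int]_2)
    (alpha : R) (v1 v2 : 'rV[R]_2) : Prop :=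
  exists V : set (torusB R B), [/\ open V, V !=set0 &
    exists f : torusB R B -> 'rV[R]_m,
      isometric_immersion (frame_metric (torusB_frame alpha v1 v2))
        (@torusB_cover R B @^-1` V) (f \o @torusB_cover R B)].

(* Main.v *)
Require Import Defs.
From HB Require Import structures.
From mathcomp Require Import all_boot all_order all_algebra.
From mathcomp Require Import all_classical all_reals all_analysis.
From mathcomp Require Import ring lra.
Set Implicit Arguments.
Unset Strict Implicit.
Unset Printing Implicit Defensive.
Import Order.TTheory GRing.Theory Num.Theory.
Import numFieldNormedType.Exports.
Local Open Scope classical_set_scope.
Local Open Scope ring_scope.

(** Around each of its points, each of these manifolds carries an orthonormal
    frame e_0, e_1, e_2 with the brackets
      [e_i, e_(i+1)] = (mu_i + mu_(i+1)) e_(i+2)     (indices modulo 3)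
    for three constants mu_i: all of them are locally unimodular Lie groups with
    a left-invariant metric, and such a frame was found by Milnor. Its
    connection is nabla_(e_i) e_(i+1) = mu_i e_(i+2),
    nabla_(e_i) e_(i+2) = - mu_i e_(i+1), and its curvature operator is diagonal,
    with entry k_i = mu_i (mu_(i+1) + mu_(i+2)) - mu_(i+1) mu_(i+2) on the plane
    of e_(i+1) and e_(i+2).

    Suppose that the manifold is a hypersurface of R^4, with shape operator S.
    The Gauss equation says that the cofactor matrix of S is diag(k_0, k_1, k_2)
    ([shape_operator]). When k_0 and k_1 are nonzero, the relation
    S adj(S) = det(S) Id forces S to be diagonal, with the numbers k_i S_ii all
    equal to det(S), and S_00 nonzero ([algebraic_gauss]). Hence
      d_2 (d_1 f) = - mu_2 d_0 f   and   d_0 (d_1 f) = mu_0 d_2 f,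
    where d_i f is the derivative of the immersion f along e_i. Differentiating
    the first relation along e_0, the second one along e_2, and comparing the
    results through the bracket [e_2, e_0] gives one Codazzi equation,
      mu_0 S_22 + mu_2 S_00 = (mu_0 + mu_2) S_11,
    which after multiplication by k_0 k_1 k_2 is a polynomial condition on the
    mu_i ([milnor_frame_not_immersed]). No manifold of the list satisfies it:
    for E(kappa, tau), mu = (tau, tau, kappa / (2 tau) - tau) and
    k = (tau^2, tau^2, kappa - 3 tau^2), so that the condition reads
    kappa = 4 tau^2; for Sol and the torus bundles, mu = (- c, c, 0) and
    k = (- c^2, - c^2, c^2) with c nonzero (c = 1 for Sol, c = ln alpha for the
    torus bundles), and the condition reads c = 0.

    The argument manipulates only inner products of the derivatives of f along
    the frame. The normal enters only pointwise, as a generator of the line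
    orthogonal to the tangent space: what is differentiated are the two relations
    above, in which it does not occur. The identities are required on a subset M
    of R^n to which the frame is tangent: M is an open set of R^3 in the
    coordinate models, and an open part of the unit sphere of R^4 for the Berger
    spheres, where the frame consists of multiples of the linear fields
    x |-> jx, kx, ix.

    The analysis behind this is the symmetry of second derivatives
    ([derive_comm]), whence the commutator of the derivatives along two vector
    fields is the derivative along their bracket ([along_bracket]). *)

(** * Symmetry of second derivatives *)

Lemma is_derive_line (R : realType) (V W : normedModType R) (f : V -> W)
    (u c : V) (s : R) :
  differentiable f (s *: u + c) ->
  is_derive s 1 (fun t : R => f (t *: u + c)) ('D_u f (s *: u + c)).
Proof.
move=> df.
have E : (fun h : R => h^-1 *: (((fun t : R => f (t *: u + c)) \o shift s) (h *: 1)
            - f (s *: u + c)))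
     = (fun h : R => h^-1 *: ((f \o shift (s *: u + c)) (h *: u)
            - f (s *: u + c))).
  apply/funext => h /=; congr (_ *: (f _ - _)).
  by rewrite scalerDl addrA -scalerA scale1r.
split; first by rewrite /derivable E; exact: (@diff_derivable _ _ _ f _ u df).
by rewrite /derive E.
Qed.

(** The mixed second difference of f over a parallelogram of sides h u, h v is, by
    the mean value theorem in the direction u, h times an increment of the
    derivative D_u f by h v, up to a common translation of both points; the
    differentiability of D_u f at the single point p then gives its limit. *)
Lemma second_difference (R : realType) (V : normedModType R) (U : set V)
    (f : V -> R) (u v p : V) :
  open U -> U p -> (forall x, U x -> differentiable f x) ->
  differentiable ('D_u f) p ->
  forall e : R, 0 < e -> \forall h \near 0^'+,
    `|f (h *: u + h *: v + p) - f (h *: u + p) - f (h *: v + p) + f p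
      - h ^+ 2 * 'D_v ('D_u f) p| <= e * h ^+ 2.
Proof.
move=> oU Up df dDf e e0.
set K := `|u| + `|v| + 1.
have K0 : 0 < K by rewrite /K ltr_wpDl// addr_ge0.
have /eqaddoP/(_ (e / (2 * K))) := diff_locally dDf.
have eK : 0 < e / (2 * K) by rewrite divr_gt0// mulr_gt0.
move=> /(_ eK) /nbhs_ballP[r /= r0 Br].
have /nbhs_ballP[d /= d0 Bd] : nbhs p U by apply: open_nbhs_nbhs.
near=> h.
have h0 : 0 < h by [].
have hd : h * K < Num.min r d.
  by rewrite -ltr_pdivlMr//; near: h; apply: nbhs_right_lt; rewrite divr_gt0// lt_min r0.
have small s t : 0 <= s <= h -> 0 <= t <= h -> `|s *: u + t *: v| <= h * K.
  move=> /andP[s0 sh] /andP[t0 th].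
  apply: (le_trans (ler_normD _ _)); rewrite !normrZ !ger0_norm// /K.
  have := normr_ge0 u; have := normr_ge0 v => v0 u0.
  have := ler_wpM2r u0 sh; have := ler_wpM2r v0 th => *.
  rewrite !mulrDr mulr1 -[leLHS]addr0 !lerD// ltW.
have inU s t : 0 <= s <= h -> 0 <= t <= h -> U (s *: u + t *: v + p).
  move=> hs ht; apply: Bd; rewrite -ball_normE /ball_/= opprD addrC subrK.
  rewrite normrN; apply: (le_lt_trans (small _ _ hs ht)).
  by move: hd; rewrite lt_min => /andP[].
(* first-order expansion of D_u f at p, valid on the whole parallelogram *)
have est s t : 0 <= s <= h -> 0 <= t <= h ->
    `|'D_u f (s *: u + t *: v + p) - 'D_u f p - 'd ('D_u f) p (s *: u + t *: v)|
      <= e / 2 * h.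
  move=> hs ht.
  have sr : ball 0 r (s *: u + t *: v).
    rewrite -ball_normE /ball_/= sub0r normrN; apply: (le_lt_trans (small _ _ hs ht)).
    by move: hd; rewrite lt_min => /andP[].
  have := Br _ sr; rewrite /= -![(_ + _ : _ -> _) _]/(_ + _) -![(- _ : _ -> _) _]/(- _) /=.
  rewrite opprD addrA => /le_trans; apply.
  have -> : e / 2 * h = e / (2 * K) * (h * K) by field; rewrite gt_eqF.
  by rewrite ler_wpM2l ?small// ltW.
pose g (s : R) := f (s *: u + (h *: v + p)) - f (s *: u + p).
have hh : 0 <= h <= h by rewrite lexx ltW.
have h00 : 0 <= (0 : R) <= h by rewrite lexx ltW.
have dg s : 0 <= s <= h -> is_derive s 1 g
    ('D_u f (s *: u + (h *: v + p)) - 'D_u f (s *: u + p)).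
  move=> hs; have H1 := inU _ _ hs hh; have H2 := inU _ _ hs h00.
  apply: is_deriveB; apply: is_derive_line; apply: df.
    by rewrite addrA.
  by move: H2; rewrite scale0r addr0.
have [c c01|s|c] := @MVT R g
  (fun s => 'D_u f (s *: u + (h *: v + p)) - 'D_u f (s *: u + p)) 0 h h0.
- by move: c01; rewrite in_itv/= => /andP[c0 ch]; apply: dg; rewrite !ltW.
- move: s; apply: derivable_within_continuous => s; rewrite in_itv/= => hs.
  by have := dg _ hs; case.
rewrite in_itv/= => /andP[c0 ch]; rewrite /g subr0 !scale0r !add0r => Eg.
have hc : 0 <= c <= h by rewrite !ltW.
have -> : f (h *: u + h *: v + p) - f (h *: u + p) - f (h *: v + p) + f p =
    f (h *: u + (h *: v + p)) - f (h *: u + p) - (f (h *: v + p) - f p).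
  by rewrite addrA opprD opprK addrA.
rewrite Eg addrA.
have := est _ _ hc hh; have := est _ _ hc h00.
rewrite scale0r addr0 linearD (deriveE _ dDf).
have -> : 'd ('D_u f) p (h *: v) = h * 'd ('D_u f) p v by rewrite linearZ.
suff fin (A B C D L : R) : `|B - C - L| <= e / 2 * h ->
    `|A - C - (L + h * D)| <= e / 2 * h -> `|(A - B) * h - h ^+ 2 * D| <= e * h ^+ 2.
  exact: fin.
move=> H1 H2.
have -> : (A - B) * h - h ^+ 2 * D = h * ((A - C - (L + h * D)) - (B - C - L)) by ring.
rewrite normrM (gtr0_norm h0).
have -> : e * h ^+ 2 = h * (e * h) by ring.
rewrite ler_pM2l//; have := ler_normB (A - C - (L + h * D)) (B - C - L); lra.
Unshelve. all: by end_near. Qed.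

(** The second difference is symmetric in u and v, so both iterated derivatives
    are the limit of its quotient by h^2. *)
Lemma derive_comm (R : realType) (V : normedModType R) (U : set V)
    (f : V -> R) (u v p : V) :
  open U -> U p -> (forall x, U x -> differentiable f x) ->
  differentiable ('D_u f) p -> differentiable ('D_v f) p ->
  'D_u ('D_v f) p = 'D_v ('D_u f) p.
Proof.
move=> oU Up df du dv; apply/eqP; rewrite -subr_eq0 -normr_eq0; apply/eqP.
apply/le_anti; rewrite normr_ge0 andbT; apply/ler_addgt0Pr => e e0; rewrite add0r.
have e20 : 0 < e / 2 by rewrite divr_gt0.
have N1 := second_difference v oU Up df du e20.
have N2 := second_difference u oU Up df dv e20.
apply: (@filter_const _ (0 : R)^'+).
apply: filterS3 N1 N2 (nbhs_right_gt (0 : R)) => h + + h0.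
rewrite [h *: v + h *: u]addrC [f _ - f _ - f (h *: u + p)]addrAC.
move: (_ + f p) => D.
suff fin (x y : R) : `|D - h ^+ 2 * x| <= e / 2 * h ^+ 2 ->
    `|D - h ^+ 2 * y| <= e / 2 * h ^+ 2 -> `|y - x| <= e by exact: fin.
move=> H1 H2; have h20 : 0 < h ^+ 2 by rewrite exprn_gt0.
rewrite -(ler_pM2l h20) -{1}(gtr0_norm h20) -normrM.
have -> : h ^+ 2 * (y - x) = (D - h ^+ 2 * x) - (D - h ^+ 2 * y) by ring.
have -> : h ^+ 2 * e = e / 2 * h ^+ 2 + e / 2 * h ^+ 2 by field.
by apply: (le_trans (ler_normB _ _)); rewrite lerD.
Qed.

(** * Functions of class C^k *)

Lemma near_eq_differentiable (R : realType) (V W : normedModType R)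
    (f g : V -> W) (x : V) :
  {near x, f =1 g} -> differentiable f x -> differentiable g x.
Proof.
move=> fg df; have gfx : g x = f x by rewrite (nbhs_singleton fg).
have cdf := diff_continuous df.
have E : g \o shift x = cst (g x) + 'd f x +o_ 0 id.
  apply/eqaddoP => e e0; have /eqaddoP/(_ e e0) := diff_locally df.
  move: fg; rewrite (near_shift 0)/= subr0.
  apply: filterS2 => y /=.
  by rewrite -![(_ + _ : _ -> _) _]/(_ + _) -![(- _ : _ -> _) _]/(- _) /= gfx => ->.
apply/diff_locallyP; have dg := diff_unique cdf E.
by split; rewrite dg.
Qed.

Lemma differentiable_component (R : realType) (V : normedModType R) (n : nat)
    (f : V -> 'rV[R]_n) (i : 'I_n) (x : V) :
  differentiable f x -> differentiable (fun y => f y 0 i) x.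
Proof.
move=> df; apply: (@differentiable_comp _ _ _ _ f (fun M : 'rV_n => M 0 i : R)) => //.
exact: differentiable_coord.
Qed.

Lemma derive_component (R : realType) (V : normedModType R) (n : nat)
    (f : V -> 'rV[R]_n) (i : 'I_n) (x v : V) :
  differentiable f x -> 'D_v (fun y => f y 0 i) x = 'D_v f x 0 i.
Proof.
by move=> df; rewrite derive_mx ?mxE//; apply: diff_derivable.
Qed.

(** On an open set only the germs count. This lets every later derivative
    computation be done pointwise on U instead of as an equality of functions. *)
Lemma Ck_on_ext (R : realType) (V W : normedModType R) (k : nat) (U : set V)
    (f g : V -> W) :
  open U -> (forall x, U x -> f x = g x) -> Ck_on k U f -> Ck_on k U g.
Proof.
move=> oU; elim: k f g => [|k IH] f g fg.
  move=> cf x Ux; have nU : nbhs x U by apply: open_nbhs_nbhs.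
  rewrite /prop_for /continuous_at -(fg _ Ux).
  apply: cvg_trans (cf _ Ux); apply: near_eq_cvg.
  by apply: filterS nU => y /fg ->.
move=> [df Df].
have nfg x : U x -> {near x, f =1 g}.
  by move=> Ux; apply: filterS (open_nbhs_nbhs (conj oU Ux)) => y /fg.
split=> [x Ux|v]; first exact: near_eq_differentiable (nfg _ Ux) (df _ Ux).
apply: IH (Df v) => x Ux; exact: near_eq_derive (nfg _ Ux).
Qed.

Lemma Ck_onW (R : realType) (V W : normedModType R) (k : nat) (U : set V)
    (f : V -> W) : Ck_on k.+1 U f -> Ck_on k U f.
Proof.
elim: k f => [f [df _] x Ux|k IH f [df Df]].
  exact: differentiable_continuous (df _ Ux).
split=> [//|v]; exact: IH (Df v).
Qed.

Lemma Ck_on_cst (R : realType) (V W : normedModType R) (k : nat) (U : set V)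
    (w : W) : Ck_on k U (fun=> w).
Proof.
elim: k w => [w x _|k IH w]; first exact: cst_continuous.
split=> [x _|v]; first exact: differentiable_cst.
have -> : (fun x : V => 'D_v (fun=> w) x) = (fun=> 0); last exact: IH.
by apply/funext => x; rewrite derive_cst.
Qed.

Section scalar_functions.
Context {R : realType} {V : normedModType R}.
Variables (U : set V) (oU : open U).
Implicit Types f g : V -> R.

Lemma Ck_onD k f g : Ck_on k U f -> Ck_on k U g ->
  Ck_on k U (fun x => f x + g x).
Proof.
elim: k f g => [|k IH] f g; first by move=> cf cg x Ux; apply: cvgD; [exact: cf|exact: cg].
move=> [df Df] [dg Dg]; split=> [x Ux|v].
  by apply: differentiableD; [exact: df|exact: dg].
apply: (Ck_on_ext oU) (IH _ _ (Df v) (Dg v)) => x Ux.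
by rewrite deriveD//; apply: diff_derivable; [exact: df|exact: dg].
Qed.

Lemma Ck_onM k f g : Ck_on k U f -> Ck_on k U g ->
  Ck_on k U (fun x => f x * g x).
Proof.
elim: k f g => [|k IH] f g; first by move=> cf cg x Ux; apply: cvgM; [exact: cf|exact: cg].
move=> Cf Cg; have [df Df] := Cf; have [dg Dg] := Cg; split=> [x Ux|v].
  by apply: differentiableM; [exact: df|exact: dg].
apply: (Ck_on_ext oU) (Ck_onD (IH _ _ (Ck_onW Cf) (Dg v)) (IH _ _ (Ck_onW Cg) (Df v))) => x Ux.
by rewrite deriveM//; apply: diff_derivable; [exact: df|exact: dg].
Qed.

Lemma Ck_on_sum k (n : nat) (f : 'I_n -> V -> R) :
  (forall i, Ck_on k U (f i)) -> Ck_on k U (fun x => \sum_(i < n) f i x).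
Proof.
elim: n f => [|n IH] f Cf.
  under eq_fun do rewrite big_ord0; exact: Ck_on_cst.
under eq_fun do rewrite big_ord_recr/=; apply: Ck_onD => //.
exact: (IH (fun i => f (widen_ord (leqnSn n) i))).
Qed.

End scalar_functions.

Section coordinates.
Context {R : realType} {n : nat}.
Implicit Types p v : 'rV[R]_n.

Lemma is_derive_coord p v (i : 'I_n) :
  is_derive p v (fun q : 'rV[R]_n => q 0 i) (v 0 i).
Proof.
have dc : differentiable (fun q : 'rV[R]_n => q 0 i : R) p by exact: differentiable_coord.
split; first exact: diff_derivable.
by rewrite (derive_component (f := id))// derive_id.
Qed.

Lemma Ck_on_coord k (U : set 'rV[R]_n) (i : 'I_n) :
  Ck_on k U (fun q : 'rV[R]_n => q 0 i).
Proof.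
case: k => [x _|k].
  apply: differentiable_continuous; exact: differentiable_coord.
split=> [x _|v]; first exact: differentiable_coord.
have -> : (fun x : 'rV[R]_n => 'D_v (fun q : 'rV[R]_n => q 0 i) x) = (fun=> v 0 i).
  by apply/funext => x; have [_ ->] := is_derive_coord x v i.
exact: Ck_on_cst.
Qed.

Lemma is_derive_coord_comp (f : R -> R) (df : R) (p v : 'rV[R]_n) (i : 'I_n) :
  is_derive (p 0 i) 1 f df -> is_derive p v (fun q : 'rV[R]_n => f (q 0 i)) (v 0 i * df).
Proof.
move=> [/derivable1_diffP dfx vdf].
have dc : differentiable (fun q : 'rV[R]_n => q 0 i : R) p by exact: differentiable_coord.
have dcomp : differentiable (fun q : 'rV[R]_n => f (q 0 i)) p.
  exact: (@differentiable_comp _ _ _ _ (fun q : 'rV[R]_n => q 0 i) f).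
split; first exact: diff_derivable.
rewrite deriveE//.
have -> : 'd (fun q : 'rV[R]_n => f (q 0 i)) p v =
    'd f (p 0 i) ('d (fun q : 'rV[R]_n => q 0 i) p v).
  by rewrite (diff_comp (g := f) dc dfx).
rewrite -(deriveE v dc); have [_ ->] := is_derive_coord p v i.
by rewrite -[X in 'd f _ X]mulr1 linearZ -(deriveE (1 : R) dfx) vdf.
Qed.

Lemma derive_sum_coord (V : normedModType R) (f : 'rV[R]_n -> V) p v :
  differentiable f p ->
  'D_v f p = \sum_(i < n) v 0 i *: 'D_(delta_mx 0 i) f p.
Proof.
move=> df; rewrite deriveE// {1}(row_sum_delta v) linear_sum.
by apply: eq_bigr => i _; rewrite linearZ/= deriveE.
Qed.

End coordinates.

Section one_coordinate.
Context {R : realType} {n : nat}.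
Implicit Types (p v : 'rV[R]_n) (i : 'I_n) (s : R).

Lemma is_derive_scaled_coord (f : R -> R) df s i p v :
  is_derive (s * p 0 i) 1 f df ->
  is_derive p v (fun q => f (s * q 0 i)) (v 0 i * (df * s)).
Proof.
move=> dfx; apply: (is_derive_coord_comp (f := fun t => f (s * t))).
have dg : is_derive (p 0 i) 1 ( *%R s) s.
  by rewrite -[X in is_derive _ _ _ X]mulr1; exact: (is_deriveZ s (is_derive_id _ _)).
exact: (is_derive1_comp dfx dg).
Qed.

Lemma differentiable_scaled_coord (f : R -> R) df s i p :
  is_derive (s * p 0 i) 1 f df -> differentiable (fun q : 'rV[R]_n => f (s * q 0 i)) p.
Proof.
move=> [/derivable1_diffP dfx _].
apply: (@differentiable_comp _ _ _ _ (fun q : 'rV[R]_n => s * q 0 i) f) => //.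
apply: differentiableM; first exact: differentiable_cst.
exact: differentiable_coord.
Qed.

Variables (U : set 'rV[R]_n) (oU : open U).

Lemma Ck_on_expR k s i : Ck_on k U (fun q : 'rV[R]_n => expR (s * q 0 i)).
Proof.
have dexp p := differentiable_scaled_coord (is_derive_expR (s * p 0 i)).
elim: k => [p _|k IH]; first exact: differentiable_continuous.
split=> // v; apply: (Ck_on_ext oU) (Ck_onM oU IH (Ck_on_cst k U (v 0 i * s))) => p _.
have [_ ->] := is_derive_scaled_coord v (is_derive_expR (s * p 0 i)).
by rewrite mulrCA mulrA.
Qed.

Lemma Ck_on_cos_sin k s i : Ck_on k U (fun q : 'rV[R]_n => cos (s * q 0 i)) /\
  Ck_on k U (fun q : 'rV[R]_n => sin (s * q 0 i)).
Proof.
have dcos p := differentiable_scaled_coord (is_derive_cos (s * p 0 i)).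
have dsin p := differentiable_scaled_coord (is_derive_sin (s * p 0 i)).
elim: k => [|k [IHc IHs]]; first by split=> p _; exact: differentiable_continuous.
split; split=> // v.
  apply: (Ck_on_ext oU) (Ck_onM oU IHs (Ck_on_cst k U (- v 0 i * s))) => p _.
  have [_ ->] := is_derive_scaled_coord v (is_derive_cos (s * p 0 i)).
  by ring.
apply: (Ck_on_ext oU) (Ck_onM oU IHc (Ck_on_cst k U (v 0 i * s))) => p _.
have [_ ->] := is_derive_scaled_coord v (is_derive_sin (s * p 0 i)).
by ring.
Qed.

End one_coordinate.

(** * Inner products and small index sets *)

Lemma I3_ind (P : 'I_3 -> Prop) : P 0 -> P 1 -> P 2 -> forall i, P i.
Proof.
move=> P0 P1 P2 [[|[|[|//]]] hi].
- by rewrite (_ : Ordinal hi = 0)//; apply/val_inj.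
- by rewrite (_ : Ordinal hi = 1)//; apply/val_inj.
- by rewrite (_ : Ordinal hi = 2)//; apply/val_inj.
Qed.

Lemma sum_I3 (V : nmodType) (f : 'I_3 -> V) : \sum_i f i = f 0 + f 1 + f 2.
Proof.
rewrite !big_ord_recl big_ord0 addr0 addrA.
by congr (f _ + f _ + f _); apply/val_inj.
Qed.

Lemma I4_ind (P : 'I_4 -> Prop) : P 0 -> P 1 -> P 2 -> P 3 -> forall i, P i.
Proof.
move=> P0 P1 P2 P3 [[|[|[|[|//]]]] hi].
- by rewrite (_ : Ordinal hi = 0)//; apply/val_inj.
- by rewrite (_ : Ordinal hi = 1)//; apply/val_inj.
- by rewrite (_ : Ordinal hi = 2)//; apply/val_inj.
- by rewrite (_ : Ordinal hi = 3)//; apply/val_inj.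
Qed.

Section dot_product.
Context {R : realType} {m : nat}.
Implicit Types u v w : 'rV[R]_m.

Lemma dotC u v : dot u v = dot v u.
Proof. by apply: eq_bigr => i _; rewrite mulrC. Qed.

Lemma dotDl u v w : dot (u + v) w = dot u w + dot v w.
Proof. by rewrite -big_split; apply: eq_bigr => i _; rewrite mxE mulrDl. Qed.

Lemma dotZl a u w : dot (a *: u) w = a * dot u w.
Proof. by rewrite mulr_sumr; apply: eq_bigr => i _; rewrite mxE mulrA. Qed.

Lemma dot0l w : dot 0 w = 0.
Proof. by rewrite /dot big1// => i _; rewrite mxE mul0r. Qed.

Lemma dotBl u v w : dot (u - v) w = dot u w - dot v w.
Proof. by rewrite dotDl -scaleN1r dotZl mulN1r. Qed.

Lemma dot_suml (I : finType) (f : I -> 'rV[R]_m) w :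
  dot (\sum_i f i) w = \sum_i dot (f i) w.
Proof. by rewrite (big_morph (fun u => dot u w) (fun u v => dotDl u v w) (dot0l w)). Qed.

Lemma dotDr u v w : dot w (u + v) = dot w u + dot w v.
Proof. by rewrite dotC dotDl !(dotC w). Qed.

Lemma dotZr a u w : dot w (a *: u) = a * dot w u.
Proof. by rewrite dotC dotZl (dotC w). Qed.

Lemma dot_gt0 u : u != 0 -> 0 < dot u u.
Proof.
move=> u0; rewrite lt_neqAle sumr_ge0 ?andbT => [|i _]; last by rewrite -expr2 sqr_ge0.
apply: contra u0; rewrite eq_sym psumr_eq0 => [/allP h|i _]; last by rewrite -expr2 sqr_ge0.
apply/eqP/rowP => i; rewrite mxE; have := h i (mem_index_enum i).
by rewrite mulf_eq0 orbb => /eqP.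
Qed.

End dot_product.

Lemma dot4 (R : realType) (u v : 'rV[R]_4) :
  dot u v = u 0 0 * v 0 0 + u 0 1 * v 0 1 + u 0 2 * v 0 2 + u 0 3 * v 0 3.
Proof.
rewrite /dot !big_ord_recl big_ord0 addr0 !addrA.
by congr (_ * _ + u _ _ * v _ _ + u _ _ * v _ _ + u _ _ * v _ _); apply/val_inj.
Qed.

(** * Derivatives along vector fields *)

(** The derivative of a vector-valued function along a vector field, taken entry
    by entry so that only scalar functions are ever differentiated. It is locked:
    iterated derivatives along different fields must not be unfolded in the
    comparison of two terms. *)
HB.lock Definition along (R : realType) (n m : nat) (X : 'rV[R]_n -> 'rV[R]_n)
    (F : 'rV[R]_n -> 'rV[R]_m) : 'rV[R]_n -> 'rV[R]_m :=
  fun p => \row_a 'D_(X p) (fun q => F q 0 a) p.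

Section along.
Context {R : realType} {n : nat}.
Notation V := 'rV[R]_n.
Implicit Types (X Y : V -> V) (p : V).

Lemma alongE m X (F : V -> 'rV[R]_m) p a :
  along X F p 0 a = 'D_(X p) (fun q => F q 0 a) p.
Proof. by rewrite along.unlock mxE. Qed.

Definition lie_bracket X Y : V -> V := fun p => along X Y p - along Y X p.

Definition Ck_row k (U : set V) m (F : V -> 'rV[R]_m) :=
  forall a, Ck_on k U (fun q => F q 0 a).

Definition diff_row m (F : V -> 'rV[R]_m) p :=
  forall a, differentiable (fun q => F q 0 a) p.

Lemma along_sum m (I : finType) (F : V -> 'rV[R]_m) (c : I -> R) (e : I -> V -> V) X p :
  diff_row F p -> X p = \sum_i c i *: e i p ->
  along X F p = \sum_i c i *: along (e i) F p.
Proof.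
move=> dF XE; apply/rowP => a; rewrite alongE summxE XE deriveE// linear_sum.
by apply: eq_bigr => i _; rewrite mxE alongE linearZ/= deriveE.
Qed.

Lemma Ck_row_diff k U m (F : V -> 'rV[R]_m) p :
  Ck_row k.+1 U F -> U p -> diff_row F p.
Proof. by move=> CF Up a; have [+ _] := CF a; apply. Qed.

Lemma Ck_row_along k U m (F : V -> 'rV[R]_m) X : open U ->
  Ck_row k U X -> Ck_row k.+1 U F -> Ck_row k U (along X F).
Proof.
move=> oU CX CF a; have [dF DF] := CF a.
apply: (Ck_on_ext oU) (Ck_on_sum oU (fun i => Ck_onM oU (CX i) (DF (delta_mx 0 i)))) => p Up.
by rewrite alongE derive_sum_coord//; exact: dF.
Qed.

Lemma Ck_rowW k U m (F : V -> 'rV[R]_m) : Ck_row k.+1 U F -> Ck_row k U F.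
Proof. by move=> CF a; apply: Ck_onW. Qed.

Lemma Ck_rowZ k U m (F : V -> 'rV[R]_m) (a : R) : open U ->
  Ck_row k U F -> Ck_row k U (fun q => a *: F q).
Proof.
move=> oU CF b; apply: (Ck_on_ext oU) (Ck_onM oU (Ck_on_cst _ U a) (CF b)) => p _.
by rewrite mxE.
Qed.

Lemma alongZ m (F : V -> 'rV[R]_m) X (a : R) p : diff_row F p ->
  along X (fun q => a *: F q) p = a *: along X F p.
Proof.
move=> dF; apply/rowP => b; rewrite mxE !alongE.
under eq_fun do rewrite mxE.
by rewrite (deriveMl (f := fun q => F q 0 b))//; exact: diff_derivable.
Qed.

Lemma along_dot m (F G : V -> 'rV[R]_m) X p : diff_row F p -> diff_row G p ->
  'D_(X p) (fun q => dot (F q) (G q)) p = dot (along X F p) (G p) + dot (F p) (along X G p).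
Proof.
move=> dF dG.
have dFG a : derivable (fun q => F q 0 a * G q 0 a) p (X p).
  by apply: diff_derivable; apply: differentiableM.
have -> : (fun q => dot (F q) (G q)) = \sum_(a < m) (fun q => F q 0 a * G q 0 a).
  by apply/funext => q; rewrite fct_sumE.
rewrite derive_sum// -big_split; apply: eq_bigr => a _ /=.
rewrite deriveM; [|exact: diff_derivable..].
by rewrite !alongE [RHS]addrC; congr (_ + _); rewrite [RHS]mulrC.
Qed.

(** Leibniz rule for a second derivative along fields: the second-order part is
    symmetric in X and Y up to the order of the partial derivatives, so only the
    first-order part survives in a commutator. *)
Lemma derive_along_twice k U (f : V -> R) X Y p : open U -> U p ->
  Ck_row k.+1 U X -> Ck_row k.+1 U Y -> Ck_on k.+2 U f ->
  'D_(X p) (fun q => 'D_(Y q) f q) p =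
  'D_(along X Y p) f p +
  \sum_(a < n) \sum_(b < n) X p 0 b * Y p 0 a * 'D_(delta_mx 0 b) ('D_(delta_mx 0 a) f) p.
Proof.
move=> oU Up CX CY [df Df].
have dY a : differentiable (fun q => Y q 0 a) p by exact: (Ck_row_diff CY Up).
have dDf v : differentiable ('D_v f) p by have [+ _] := Df v; apply.
have dYf a : derivable (fun q => Y q 0 a * 'D_(delta_mx 0 a) f q) p (X p).
  by apply: diff_derivable; apply: differentiableM.
have -> : 'D_(X p) (fun q => 'D_(Y q) f q) p =
    'D_(X p) (\sum_(a < n) (fun q => Y q 0 a * 'D_(delta_mx 0 a) f q)) p.
  apply: near_eq_derive; apply: filterS (open_nbhs_nbhs (conj oU Up)) => q Uq.
  by rewrite fct_sumE derive_sum_coord//; exact: df.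
rewrite derive_sum// (derive_sum_coord (along X Y p) (df _ Up)) -big_split.
apply: eq_bigr => a _ /=; rewrite deriveM; [|exact: diff_derivable..].
rewrite [RHS]addrC alongE; congr (_ + _); last exact: mulrC.
rewrite (derive_sum_coord (X p) (dDf _)).
by rewrite scaler_sumr; apply: eq_bigr => b _; rewrite scalerA mulrC.
Qed.

Lemma along_bracket k U m (F : V -> 'rV[R]_m) X Y p : open U -> U p ->
  Ck_row k.+1 U X -> Ck_row k.+1 U Y -> Ck_row k.+2 U F ->
  along X (along Y F) p - along Y (along X F) p = along (lie_bracket X Y) F p.
Proof.
move=> oU Up CX CY CF; apply/rowP => c; rewrite !(mxE, alongE).
under [X in 'D__ X _ - _]eq_fun do rewrite alongE.
under [X in _ - 'D__ X _]eq_fun do rewrite alongE.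
have [df Df] := CF c.
have dDf v q : U q -> differentiable ('D_v (fun q => F q 0 c)) q.
  by have [+ _] := Df v; apply.
rewrite !(@derive_along_twice k U)//.
rewrite /lie_bracket [X in _ = X]deriveE ?linearB//=; last exact: df.
rewrite -!deriveE; [|exact: df..].
rewrite addrAC opprD addrA -[RHS]addr0 -addrA; congr (_ - _ + _).
apply/eqP; rewrite addrC subr_eq0; apply/eqP; rewrite exchange_big.
apply: eq_bigr => a _; apply: eq_bigr => b _; rewrite (mulrC (Y p 0 b)).
rewrite (derive_comm oU Up (f := fun q => F q 0 c))//; exact: dDf.
Qed.

End along.

Section field_algebra.
Context {R : realType} {n m : nat}.
Implicit Types (F G : 'rV[R]_n -> 'rV[R]_m).

Lemma diff_rowZ a F p : diff_row F p -> diff_row (fun q => a *: F q) p.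
Proof.
move=> dF b; under eq_fun do rewrite mxE.
exact: (differentiableM (differentiable_cst a p) (dF b)).
Qed.

Lemma alongD F G X p : diff_row F p -> diff_row G p ->
  along X (fun q => F q + G q) p = along X F p + along X G p.
Proof.
move=> dF dG; apply/rowP => b; rewrite mxE !alongE.
under eq_fun do rewrite mxE.
by rewrite (deriveD (f := fun q => F q 0 b) (g := fun q => G q 0 b))//; exact: diff_derivable.
Qed.

Lemma along_cst v X p : along X (fun _ : 'rV[R]_n => v : 'rV[R]_m) p = 0.
Proof. by apply/rowP => b; rewrite alongE derive_cst mxE. Qed.

Lemma Ck_rowD k (U : set 'rV[R]_n) F G : open U ->
  Ck_row k U F -> Ck_row k U G -> Ck_row k U (fun q => F q + G q).
Proof.
move=> oU CF CG a; apply: (Ck_on_ext oU) (Ck_onD oU (CF a) (CG a)) => p _.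
by rewrite mxE.
Qed.

End field_algebra.

Lemma smooth_Ck_row (R : realType) (n m k : nat) (U : set 'rV[R]_n)
    (f : 'rV[R]_n -> 'rV[R]_m) : open U -> smooth_on U f -> Ck_row k U f.
Proof.
move=> oU sf a; have := sf k; elim: k f {sf} => [f Cf p Up|k IH f [df Df]].
  apply: (@continuous_comp _ _ _ f (fun M : 'rV[R]_m => M 0 a)); first exact: Cf.
  exact: coord_continuous.
split=> [p Up|v]; first exact: differentiable_component (df _ Up).
apply: (Ck_on_ext oU) (IH _ (Df v)) => p Up.
by rewrite derive_component//; exact: df.
Qed.

Lemma along_diff (R : realType) (n m : nat) (F : 'rV[R]_n -> 'rV[R]_m) X p :
  differentiable F p -> along X F p = 'd F p (X p).
Proof.
move=> dF; apply/rowP => a; rewrite alongE derive_component//.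
by rewrite deriveE.
Qed.

(** * Frames of immersions with constant structure constants *)

(** Tangency is expressed by its only consequence that matters: a function that
    vanishes on M has zero derivative along X on M. This covers open sets and
    the sphere alike, and makes identities that hold only on M differentiable
    along X. *)
Definition tangent_field (R : realType) (n : nat) (M : set 'rV[R]_n)
    (X : 'rV[R]_n -> 'rV[R]_n) :=
  forall (g : 'rV[R]_n -> R) p, M p -> differentiable g p ->
    (forall q, M q -> g q = 0) -> 'D_(X p) g p = 0.

(** Koszul formula for an orthonormal frame with structure constants c. *)
Definition christoffel (R : realType) (r : nat) (c : 'I_r -> 'I_r -> 'I_r -> R)
    (i j k : 'I_r) : R :=
  (c i j k - c j k i + c k i j) / 2.

Section frame_geometry.
Context {R : realType} {n m r : nat}.
Notation V := 'rV[R]_n.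
Variables (U M : set V) (e : 'I_r -> V -> V) (F : V -> 'rV[R]_m).
Variable c : 'I_r -> 'I_r -> 'I_r -> R.
Hypotheses (oU : open U) (MU : M `<=` U).
Hypothesis Ce : forall i, Ck_row 2 U (e i).
Hypothesis CF : Ck_row 3 U F.
Hypothesis tgt : forall i, tangent_field M (e i).
Hypothesis bracket : forall i j p, M p ->
  lie_bracket (e i) (e j) p = \sum_k c i j k *: e k p.

Notation E i := (along (e i) F).
Notation DE i j := (along (e i) (E j)).

Hypothesis orthonormal : forall i j p, M p -> dot (E i p) (E j p) = (i == j)%:R.

Lemma tangent_cst i (g : V -> R) (a : R) p : M p -> differentiable g p ->
  (forall q, M q -> g q = a) -> 'D_(e i p) g p = 0.
Proof.
move=> Mp dg ga.
have dga : differentiable (fun q => g q - a) p.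
  by apply: differentiableB => //; exact: differentiable_cst.
have := tgt i Mp dga; rewrite deriveB; [|exact: diff_derivable|exact: derivable_cst].
by rewrite derive_cst subr0; apply=> q Mq; rewrite ga// subrr.
Qed.

Lemma along_tangent i k (G H : V -> 'rV[R]_m) p : Ck_row k.+1 U G -> Ck_row k.+1 U H ->
  (forall q, M q -> G q = H q) -> M p -> along (e i) G p = along (e i) H p.
Proof.
move=> CG CH GH Mp; apply/rowP => a; rewrite !alongE.
have dG := Ck_row_diff CG (MU Mp) a; have dH := Ck_row_diff CH (MU Mp) a.
apply/eqP; rewrite -subr_eq0 -deriveB; [|exact: diff_derivable..].
apply/eqP; apply: tgt => // [|q Mq]; first exact: differentiableB.
by rewrite /GRing.add/= GH// /GRing.opp/= subrr.
Qed.

Lemma Ck_E i : Ck_row 2 U (E i).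
Proof. exact: Ck_row_along. Qed.

Lemma Ck_DE i j : Ck_row 1 U (DE i j).
Proof. by apply: Ck_row_along => //; [exact: Ck_rowW|exact: Ck_E]. Qed.

(** Both derivatives of a constant inner product cancel. This gives the skew
    symmetry of the connection when applied to the frame, and moves one
    derivative onto the other factor in the Gauss equation. *)
Lemma along_dot_cst i (G H : V -> 'rV[R]_m) a p :
  Ck_row 1 U G -> Ck_row 1 U H -> (forall q, M q -> dot (G q) (H q) = a) -> M p ->
  dot (along (e i) G p) (H p) = - dot (G p) (along (e i) H p).
Proof.
move=> CG CH GH Mp; apply/eqP; rewrite -addr_eq0.
have dG := Ck_row_diff CG (MU Mp); have dH := Ck_row_diff CH (MU Mp).
rewrite -along_dot//; apply/eqP; apply: tangent_cst GH => //.
have -> : (fun q => dot (G q) (H q)) = \sum_(a < m) (fun q => G q 0 a * H q 0 a).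
  by apply/funext => q; rewrite fct_sumE.
by apply: differentiable_sum => b; apply: differentiableM.
Qed.

(** The second derivatives of F commute up to the bracket, which is the torsion
    freeness of the connection induced by the immersion. *)
Lemma torsion_free i j p : M p ->
  DE i j p - DE j i p = \sum_k c i j k *: E k p.
Proof.
move=> Mp; have Up := MU Mp.
rewrite (along_bracket (k := 1) oU Up)//; try by move=> *; exact: Ce.
apply: along_sum; last exact: bracket.
exact: Ck_row_diff CF Up.
Qed.

Lemma koszul i j k p : M p -> dot (DE i j p) (E k p) = christoffel c i j k.
Proof.
move=> Mp.
have anti a b d : dot (DE a b p) (E d p) = - dot (DE a d p) (E b p).
  rewrite (along_dot_cst a (G := E b) (H := E d) (a := (b == d)%:R))//; first by rewrite dotC.
  - exact/Ck_rowW/Ck_E.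
  - exact/Ck_rowW/Ck_E.
  - by move=> q; apply: orthonormal.
have tors a b d : dot (DE a b p) (E d p) = dot (DE b a p) (E d p) + c a b d.
  have := torsion_free a b Mp => /(congr1 (fun v => dot v (E d p))).
  rewrite dotBl dot_suml (bigD1 d)//= dotZl orthonormal// eqxx mulr1 big1 ?addr0.
    by move=> /eqP; rewrite subr_eq addrC => /eqP.
  by move=> l ld; rewrite dotZl orthonormal// (negPf ld) mulr0.
rewrite /christoffel.
have := anti i j k; have := anti j k i; have := anti k i j.
have := tors i j k; have := tors j k i; have := tors k i j.
lra.
Qed.

(** Flatness of the ambient space: the commutator of two derivatives of E k is
    its derivative along the bracket; taking the inner product with E l, each
    second derivative becomes a product of first derivatives because
    the Christoffel symbols are constant. *)
Lemma gauss i j k l p : M p ->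
  dot (DE i k p) (DE j l p) - dot (DE j k p) (DE i l p) =
  \sum_s c i j s * christoffel c s k l.
Proof.
move=> Mp; have Up := MU Mp.
have diff2 a b : dot (along (e a) (DE b k) p) (E l p) = - dot (DE b k p) (DE a l p).
  apply: (along_dot_cst a (G := DE b k) (H := E l) (a := christoffel c b k l)) => //.
  - exact: Ck_DE.
  - exact/Ck_rowW/Ck_E.
  - by move=> q Mq; rewrite koszul.
have : along (e i) (DE j k) p - along (e j) (DE i k) p = \sum_s c i j s *: DE s k p.
  rewrite (along_bracket (k := 0) oU Up); first last.
  - exact: Ck_E.
  - exact: Ck_rowW.
  - exact: Ck_rowW.
  apply: along_sum; last exact: bracket.
  exact: Ck_row_diff (Ck_E k) Up.
move=> /(congr1 (fun v => dot v (E l p))); rewrite dotBl !diff2 dot_suml opprK addrC => ->.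
by apply: eq_bigr => s _; rewrite dotZl koszul.
Qed.

(** When the normal space is the line spanned by N, the second derivatives split
    into the Christoffel part and a multiple S of N, and the Gauss equation turns
    into a statement on the 2x2 minors of S. *)
Lemma shape_operator (N : 'rV[R]_m) p : M p ->
    (forall i, dot N (E i p) = 0) -> dot N N != 0 ->
    (forall x : 'rV[R]_m, (forall i, dot x (E i p) = 0) -> exists s, x = s *: N) ->
  exists S : 'I_r -> 'I_r -> R,
    [/\ forall i j, DE i j p = \sum_k christoffel c i j k *: E k p + S i j *: N,
        forall i j, S i j = S j i &
        forall i j k l, dot N N * (S i k * S j l - S j k * S i l) =
          \sum_s (c i j s * christoffel c s k l
                - christoffel c i k s * christoffel c j l s
                + christoffel c j k s * christoffel c i l s)].
Proof.
move=> Mp NE N0 line.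
have frame_dot (a : 'I_r -> R) i : dot (\sum_k a k *: E k p) (E i p) = a i.
  rewrite dot_suml (bigD1 i)//= dotZl orthonormal// eqxx mulr1 big1 ?addr0// => k ki.
  by rewrite dotZl orthonormal// (negPf ki) mulr0.
have frame_dotN (a : 'I_r -> R) : dot (\sum_k a k *: E k p) N = 0.
  by rewrite dot_suml big1// => k _; rewrite dotZl dotC NE mulr0.
have normal i j : exists s, DE i j p - \sum_k christoffel c i j k *: E k p = s *: N.
  by apply: line => k; rewrite dotBl koszul// frame_dot subrr.
pose S i j := sval (cid (normal i j)).
have SE i j : DE i j p = \sum_k christoffel c i j k *: E k p + S i j *: N.
  by rewrite -(svalP (cid (normal i j))) addrC subrK.
exists S; split=> // [i j|i j k l].
  have := torsion_free i j Mp => /(congr1 (fun v => dot v N)).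
  rewrite dotBl frame_dotN !SE !dotDl !frame_dotN !add0r !dotZl -mulrBl => /eqP.
  by rewrite mulf_eq0 (negPf N0) orbF subr_eq0 => /eqP.
rewrite !big_split/= -(gauss i j k l Mp) sumrN.
have prod a b d f : dot (DE a b p) (DE d f p) =
    \sum_s christoffel c a b s * christoffel c d f s + S a b * S d f * dot N N.
  rewrite (SE a b) dotDl dot_suml dotZl; congr (_ + _).
    by apply: eq_bigr => s _; rewrite dotZl dotC koszul.
  by rewrite (SE d f) dotDr dotZr dotC frame_dotN add0r mulrA.
rewrite !prod; ring.
Qed.

End frame_geometry.

(** The orthogonal of an orthonormal family of n vectors is the kernel of a matrix
    of rank n with n+1 columns. *)
Lemma normal_line (R : realType) (n : nat) (E : 'I_n -> 'rV[R]_n.+1) :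
  (forall i j, dot (E i) (E j) = (i == j)%:R) ->
  exists N : 'rV[R]_n.+1, [/\ forall i, dot N (E i) = 0, N != 0 &
    forall x : 'rV[R]_n.+1, (forall i, dot x (E i) = 0) -> exists s, x = s *: N].
Proof.
move=> ortho; pose A := \matrix_(i < n) E i.
have dotA (x : 'rV[R]_n.+1) i : dot x (E i) = (x *m A^T) 0 i.
  by rewrite mxE; apply: eq_bigr => j _; rewrite !mxE.
have kerP (x : 'rV[R]_n.+1) : (forall i, dot x (E i) = 0) <-> (x <= kermx A^T)%MS.
  split=> [h|/sub_kermxP h i]; last by rewrite dotA h mxE.
  by apply/sub_kermxP/rowP => i; rewrite -dotA h mxE.
have rkA : \rank A^T = n.
  rewrite mxrank_tr; apply/eqP/row_freeP; exists A^T.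
  by apply/matrixP => i j; rewrite !mxE -ortho; apply: eq_bigr => k _; rewrite !mxE.
have rkK : \rank (kermx A^T) = 1%N by rewrite mxrank_ker rkA subSnn.
have K0 : kermx A^T != 0 by rewrite -mxrank_eq0 rkK.
have NK := nz_row_sub (kermx A^T); have N0 := K0; rewrite -nz_row_eq0 in N0.
exists (nz_row (kermx A^T)); split=> // [i|x /kerP xK]; first by move/kerP: NK.
apply/sub_rVP; apply: submx_trans xK _.
by rewrite -(mxrank_leqif_sup NK) rkK rank_rV N0.
Qed.

(** * Milnor frames and hypersurfaces of R^4 *)

(** The sign of the permutation (i, j, k) of the cyclic group of order 3, and 0
    when two of the indices coincide. *)
Definition levi_civita (R : realType) (i j k : 'I_3) : R :=
  (i + 1 == j)%:R * (j + 1 == k)%:R - (k + 1 == j)%:R * (j + 1 == i)%:R.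

Lemma levi_civitaE (R : realType) :
  (forall i j, levi_civita R i i j = 0) * (forall i j, levi_civita R i j i = 0) *
  (forall i j, levi_civita R i j j = 0) *
  (levi_civita R 0 1 2 = 1) * (levi_civita R 1 2 0 = 1) * (levi_civita R 2 0 1 = 1) *
  (levi_civita R 0 2 1 = -1) * (levi_civita R 1 0 2 = -1) * (levi_civita R 2 1 0 = -1).
Proof.
have eqI (a b : 'I_3) : (a == b) = (val a == val b) by [].
do !split; try (apply: I3_ind; apply: I3_ind); rewrite /levi_civita !eqI /=.
all: by rewrite ?(mulr0, mul0r, mulr1, subrr, subr0, sub0r, oppr0).
Qed.

Section Milnor_frame.
Context {R : realType} {n : nat}.
Notation V := 'rV[R]_n.
Variables (U M : set V) (e : 'I_3 -> V -> V) (F : V -> 'rV[R]_4).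
Variable mu : 'I_3 -> R.

Definition milnor_const (i j k : 'I_3) : R := levi_civita R i j k * (mu i + mu j).

(** For (i, j, k) a cyclic permutation of (0, 1, 2), the sectional curvature of
    the plane spanned by e_j and e_k. *)
Definition milnor_curv (i j k : 'I_3) : R := mu i * (mu j + mu k) - mu j * mu k.

Lemma christoffel_milnor i j k :
  christoffel milnor_const i j k = levi_civita R i j k * mu i.
Proof.
by move: i j k; do 3!apply: I3_ind; rewrite /christoffel /milnor_const !levi_civitaE; field.
Qed.

(** The Gauss equation says that q times the cofactor matrix of S is the diagonal
    matrix of the curvatures; S is then diagonal because the off-diagonal
    entries of the product of S by its cofactor matrix vanish. *)
Lemma algebraic_gauss (S : 'I_3 -> 'I_3 -> R) (q : R) :
  0 < q -> milnor_curv 0 1 2 != 0 -> milnor_curv 1 2 0 != 0 ->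
  (forall i j, S i j = S j i) ->
  (forall i j k l, q * (S i k * S j l - S j k * S i l) =
    \sum_s (milnor_const i j s * christoffel milnor_const s k l
          - christoffel milnor_const i k s * christoffel milnor_const j l s
          + christoffel milnor_const j k s * christoffel milnor_const i l s)) ->
  [/\ S 0 1 = 0, S 1 2 = 0, S 0 2 = 0 &
   [/\ milnor_curv 0 1 2 * S 0 0 = milnor_curv 1 2 0 * S 1 1,
       milnor_curv 2 0 1 * S 2 2 = milnor_curv 1 2 0 * S 1 1 & S 0 0 != 0]].
Proof.
move=> q0 k0 k1 sym G.
have := (G 1 2 1 2, G 2 0 2 0, G 0 1 0 1, G 1 2 2 0, G 1 2 0 1, G 2 0 0 1).
rewrite !sum_I3 !christoffel_milnor /milnor_const !levi_civitaE.
rewrite (sym 2 1) (sym 2 0) (sym 1 0).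
rewrite !(mul0r, mulr0, mul1r, mulN1r, mulrN, mulNr, subr0, add0r, addr0, oppr0, opprK).
rewrite /milnor_curv in k0 k1 *.
move: (S 0 0) (S 1 1) (S 2 2) (S 1 2) (S 0 2) (S 0 1) (mu 0) (mu 1) (mu 2) k0 k1.
move=> a b d x y z m0 m1 m2 k0 k1 [[[[[E0 E1] E2] E3] E4] E5].
have {}E0 : q * (b * d - x * x) = m0 * (m1 + m2) - m1 * m2 by rewrite E0; ring.
have {}E1 : q * (d * a - y * y) = m1 * (m2 + m0) - m2 * m0 by rewrite E1; ring.
have {}E2 : q * (a * b - z * z) = m2 * (m0 + m1) - m0 * m1 by rewrite E2; ring.
rewrite -E0 -E1 -E2 in k0 k1 *.
(* Each identity below is an off-diagonal entry of S adj(S) = det(S) Id. *)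
have z0 : z = 0.
  apply: (mulfI k1); rewrite mulr0.
  have -> : q * (d * a - y * y) * z =
    - a * (q * (x * y - d * z)) - y * (q * (y * z - a * x)) by ring.
  by rewrite E3 E5 !mulr0 subrr.
have x0 : x = 0.
  apply: (mulfI k1); rewrite mulr0.
  have -> : q * (d * a - y * y) * x =
    - y * (q * (x * y - d * z)) - d * (q * (y * z - a * x)) by ring.
  by rewrite E3 E5 !mulr0 subrr.
have y0 : y = 0.
  apply: (mulfI k0); rewrite mulr0.
  have -> : q * (b * d - x * x) * y =
    - x * (q * (x * y - d * z)) - d * (q * (z * x - y * b)) by ring.
  by rewrite E3 E4 !mulr0 subrr.
split=> //; split; rewrite ?x0 ?y0 ?z0; [ring|ring|].
by apply: contra_neq k1 => ->; rewrite y0 !mulr0 subrr mulr0.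
Qed.

Hypotheses (oU : open U) (MU : M `<=` U).
Hypothesis Ce : forall i, Ck_row 2 U (e i).
Hypothesis CF : Ck_row 3 U F.
Hypothesis tgt : forall i, tangent_field M (e i).
Hypothesis orthonormal : forall i j p, M p ->
  dot (along (e i) F p) (along (e j) F p) = (i == j)%:R.
Hypothesis bracket01 : forall p, M p -> lie_bracket (e 0) (e 1) p = (mu 0 + mu 1) *: e 2 p.
Hypothesis bracket12 : forall p, M p -> lie_bracket (e 1) (e 2) p = (mu 1 + mu 2) *: e 0 p.
Hypothesis bracket20 : forall p, M p -> lie_bracket (e 2) (e 0) p = (mu 2 + mu 0) *: e 1 p.

Lemma milnor_bracket i j p : M p ->
  lie_bracket (e i) (e j) p = \sum_k milnor_const i j k *: e k p.
Proof.
move=> Mp; rewrite sum_I3 /milnor_const.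
have antisym X Y : lie_bracket X Y p = - lie_bracket Y X p by rewrite opprB.
have diag X : lie_bracket X X p = 0 by rewrite /lie_bracket subrr.
move: i j; do 2!apply: I3_ind;
  rewrite ?diag !levi_civitaE ?(mul0r, mul1r, mulN1r, scale0r, addr0, add0r)//.
- exact: bracket01.
- by rewrite antisym bracket20// scaleNr addrC.
- by rewrite antisym bracket01// scaleNr addrC.
- exact: bracket12.
- exact: bracket20.
- by rewrite antisym bracket12// scaleNr addrC.
Qed.

(** The immersion has, in the given frame, a diagonal second fundamental form
    whose entries are inversely proportional to the curvatures. The normal N and
    the entries a i depend on p, without any continuity. *)
Lemma second_fundamental_form p : milnor_curv 0 1 2 != 0 -> milnor_curv 1 2 0 != 0 -> M p ->
  exists (N : 'rV[R]_4) (a : 'I_3 -> R),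
    [/\ N != 0, a 0 != 0,
        forall i j, along (e i) (along (e j) F) p =
          \sum_k (levi_civita R i j k * mu i) *: along (e k) F p
          + (if i == j then a i else 0) *: N,
        milnor_curv 0 1 2 * a 0 = milnor_curv 1 2 0 * a 1 &
        milnor_curv 2 0 1 * a 2 = milnor_curv 1 2 0 * a 1].
Proof.
move=> k0 k1 Mp.
have [N [NE N0 line]] := normal_line (fun i j => orthonormal i j Mp).
have NN := dot_gt0 N0.
have [S [SE sym G]] := shape_operator oU MU Ce CF tgt milnor_bracket orthonormal
  Mp NE (lt0r_neq0 NN) line.
have [S01 S12 S02 [E0 E2 a0]] := algebraic_gauss NN k0 k1 sym G.
exists N, (fun i => S i i); split=> // i j.
rewrite SE; congr (_ + _ *: _).
  by apply: eq_bigr => k _; rewrite christoffel_milnor.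
have off k l : k != l -> S k l = 0.
  by move: k l; do 2!apply: I3_ind => //; rewrite sym.
by case: eqVneq => [->|/off].
Qed.

(** The last hypothesis is the failure of the Codazzi equation for the second
    fundamental form prescribed by the Gauss equation. *)
Theorem milnor_frame_not_immersed : M !=set0 ->
  milnor_curv 0 1 2 != 0 -> milnor_curv 1 2 0 != 0 ->
  milnor_curv 0 1 2 * (milnor_curv 1 2 0 - milnor_curv 2 0 1) * mu 0
    + milnor_curv 2 0 1 * (milnor_curv 1 2 0 - milnor_curv 0 1 2) * mu 2 != 0 ->
  False.
Proof.
move=> [p Mp] k0 k1 codazzi.
have CE i : Ck_row 2 U (along (e i) F) by exact: Ck_row_along.
have CDE i j : Ck_row 1 U (along (e i) (along (e j) F)).
  by apply: Ck_row_along => //; exact: Ck_rowW.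
have D21 q : M q -> along (e 2) (along (e 1) F) q = - mu 2 *: along (e 0) F q.
  move=> Mq; have [N [a [_ _ -> _ _]]] := second_fundamental_form k0 k1 Mq.
  by rewrite sum_I3 !levi_civitaE (_ : (_ == _) = false)// !mul0r !scale0r mulN1r !addr0.
have D01 q : M q -> along (e 0) (along (e 1) F) q = mu 0 *: along (e 2) F q.
  move=> Mq; have [N [a [_ _ -> _ _]]] := second_fundamental_form k0 k1 Mq.
  by rewrite sum_I3 !levi_civitaE (_ : (_ == _) = false)// !mul0r !scale0r mul1r !add0r addr0.
have [N [a [N0 a0 DE E0 E2]]] := second_fundamental_form k0 k1 Mp.
have D i : along (e i) (along (e i) F) p = a i *: N.
  by rewrite DE sum_I3 !levi_civitaE eqxx !mul0r !scale0r !add0r.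
(* The two relations hold on M only, and are differentiated along M. *)
have D021 : along (e 0) (along (e 2) (along (e 1) F)) p = - mu 2 *: (a 0 *: N).
  rewrite -D -alongZ; last exact: Ck_row_diff (CE 0) (MU Mp).
  by apply: (along_tangent MU tgt 0 (k := 0)) D21 Mp => //; apply/Ck_rowZ => //; exact/Ck_rowW.
have D201 : along (e 2) (along (e 0) (along (e 1) F)) p = mu 0 *: (a 2 *: N).
  rewrite -D -alongZ; last exact: Ck_row_diff (CE 2) (MU Mp).
  by apply: (along_tangent MU tgt 2 (k := 0)) D01 Mp => //; apply/Ck_rowZ => //; exact/Ck_rowW.
have := along_bracket (k := 0) oU (MU Mp) (Ck_rowW (Ce 2)) (Ck_rowW (Ce 0)) (CE 1).
rewrite D021 D201 (along_sum (c := fun k => milnor_const 2 0 k) (e := e)); first last.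
- exact: milnor_bracket.
- exact: Ck_row_diff (CE 1) (MU Mp).
rewrite sum_I3 /milnor_const !levi_civitaE !mul0r !scale0r add0r addr0 mul1r D.
rewrite !scalerA -scalerBl => /eqP.
rewrite -subr_eq0 -scalerBl scaler_eq0 (negPf N0) orbF => /eqP.
move: codazzi k0 k1 a0 E0 E2.
move: (milnor_curv _ _ _) (milnor_curv _ _ _) (milnor_curv _ _ _) => K2 K1 K0.
move: (a 0) (a 1) (a 2) (mu 0) (mu 2) => x y z m0 m2 codazzi k0 k1 x0 E0 E2 E.
(* the Codazzi equation E times K0 K1 K2, the K_i being simplified against
   x, y, z through E0 and E2 *)
have /eqP := mulf_neq0 codazzi (mulf_neq0 k0 x0); apply.
have -> : (K0 * (K1 - K2) * m0 + K2 * (K1 - K0) * m2) * (K0 * x) =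
    K0 * K1 * K2 * (m0 * z - - m2 * x - (m2 + m0) * y)
    + K0 * (K1 - K2) * m0 * (K0 * x - K1 * y) + K0 * K1 * m0 * (K1 * y - K2 * z)
    + K0 * K2 * m2 * (K1 * y - K0 * x) by ring.
by rewrite E E0 E2 !subrr !mulr0 !addr0.
Qed.

End Milnor_frame.

Lemma tangent_field_open (R : realType) (n : nat) (U : set 'rV[R]_n) X :
  open U -> tangent_field U X.
Proof.
move=> oU g p Up _ g0; rewrite -(derive_cst (0 : R) p (X p)); apply: near_eq_derive.
by apply: filterS (open_nbhs_nbhs (conj oU Up)) => q /g0.
Qed.

(** The case of an open set of R^n, on which every field is tangent. *)
Theorem milnor_frame_not_immersible (R : realType) (n : nat) (g : metric R n)
    (U : set 'rV[R]_n) (e : 'I_3 -> 'rV[R]_n -> 'rV[R]_n) (mu : 'I_3 -> R) :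
  open U -> U !=set0 -> (forall i, Ck_row 2 U (e i)) ->
  (forall i j p, U p -> g p (e i p) (e j p) = (i == j)%:R) ->
  (forall p, U p -> lie_bracket (e 0) (e 1) p = (mu 0 + mu 1) *: e 2 p) ->
  (forall p, U p -> lie_bracket (e 1) (e 2) p = (mu 1 + mu 2) *: e 0 p) ->
  (forall p, U p -> lie_bracket (e 2) (e 0) p = (mu 2 + mu 0) *: e 1 p) ->
  milnor_curv mu 0 1 2 != 0 -> milnor_curv mu 1 2 0 != 0 ->
  milnor_curv mu 0 1 2 * (milnor_curv mu 1 2 0 - milnor_curv mu 2 0 1) * mu 0
    + milnor_curv mu 2 0 1 * (milnor_curv mu 1 2 0 - milnor_curv mu 0 1 2) * mu 2 != 0 ->
  forall f : 'rV[R]_n -> 'rV[R]_4, ~ isometric_immersion g U f.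
Proof.
move=> oU U0 Ce ortho b01 b12 b20 k0 k1 codazzi f [sf isof].
apply: (@milnor_frame_not_immersed R n U U e f mu) => //.
- exact: smooth_Ck_row.
- by move=> i; apply: tangent_field_open.
- move=> i j p Up; have [df _] := sf 1%N.
  by rewrite !along_diff ?isof ?ortho//; exact: df.
Qed.

(** * Sol *)

Section sol_frame.
Context {R : realType}.
Notation V := 'rV[R]_3.

Definition exp_field (s : R) (h : V) : V -> V := fun q => expR (s * q 0 2) *: h.

Lemma Ck_exp_field k (U : set V) s h : open U -> Ck_row k U (exp_field s h).
Proof.
move=> oU a.
have := Ck_onM oU (Ck_on_expR oU k s 2) (Ck_on_cst k U (h 0 a)).
apply: (Ck_on_ext oU) => p _.
by rewrite mxE.
Qed.

Lemma along_exp_field s h X p :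
  along X (exp_field s h) p = (s * X p 0 2) *: exp_field s h p.
Proof.
apply/rowP => a; rewrite alongE !mxE.
under eq_fun do rewrite mxE.
have [dx vx] := is_derive_scaled_coord (X p) (is_derive_expR (s * p 0 2)).
rewrite (_ : (fun q : V => _) = h 0 a \*o (fun q : V => expR (s * q 0 2))); last first.
  by apply/funext => q /=; rewrite mulrC.
by rewrite deriveMl// vx; ring.
Qed.

(** The frame e^(- c z) h1, e^(c z) h2, d_z with h1, h2 horizontal has the brackets
    [u1, u2] = 0, [u1, u3] = c u1, [u2, u3] = - c u2. Rotating u1 and u2 by an
    eighth of a turn makes it a Milnor frame:
    with a = (u1 + u2) / sqrt 2 and b = (u1 - u2) / sqrt 2,
    [a, b] = 0, [b, u3] = c a, [u3, a] = - c b. *)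
Theorem sol_frame_not_immersible (g : metric R 3) (U : set V) (c : R) (h1 h2 : V) :
  open U -> U !=set0 -> c != 0 -> h1 0 2 = 0 -> h2 0 2 = 0 ->
  (forall p, U p -> let u1 := exp_field (- c) h1 p in let u2 := exp_field c h2 p in
    let u3 := delta_mx 0 2 in
    [/\ g p u1 u1 = 1, g p u2 u2 = 1, g p u3 u3 = 1 &
     [/\ g p u1 u2 = 0, g p u1 u3 = 0 & g p u2 u3 = 0]]) ->
  (forall p u v w (a : R), g p (a *: u + v) w = a * g p u w + g p v w) ->
  (forall p u v, g p u v = g p v u) ->
  forall f : V -> 'rV[R]_4, ~ isometric_immersion g U f.
Proof.
move=> oU U0 c0 h1z h2z orth glin gsym.
pose r : R := Num.sqrt (1 / 2).
have r2 : r * r = 1 / 2 by rewrite -expr2 sqr_sqrtr// divr_ge0.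
pose u1 := exp_field (- c) h1; pose u2 := exp_field c h2.
pose a q := r *: u1 q + r *: u2 q.
pose b q := r *: u1 q + (- r) *: u2 q.
pose e (i : 'I_3) := if i == 0 then a else if i == 1 then b else fun=> delta_mx 0 2.
pose mu (i : 'I_3) := if i == 0 then - c else if i == 1 then c else 0.
have d1 p : diff_row u1 p by apply: (Ck_row_diff (Ck_exp_field 1 _ _ openT)).
have d2 p : diff_row u2 p by apply: (Ck_row_diff (Ck_exp_field 1 _ _ openT)).
have ruz s p : (r *: u1 p + s *: u2 p) 0 2 = 0.
  by rewrite !mxE h1z h2z !mulr0 addr0.
have ab X p s t : along X (fun q => s *: u1 q + t *: u2 q) p =
   X p 0 2 *: (c *: (- s *: u1 p + t *: u2 p)).
  rewrite alongD ?alongZ//; try exact: diff_rowZ.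
  rewrite !along_exp_field; apply/rowP => k; rewrite !mxE; ring.
apply: (@milnor_frame_not_immersible R 3 g U e mu) => //.
- apply: I3_ind => //=; last by move=> k; exact: Ck_on_cst.
    by apply: Ck_rowD => //; apply: Ck_rowZ => //; exact: Ck_exp_field.
  by apply: Ck_rowD => //; apply: Ck_rowZ => //; exact: Ck_exp_field.
- move=> i j p Up; have [g11 g22 g33 [g12 g13 g23]] := orth p Up.
  have gcomb s t w : g p (s *: u1 p + t *: u2 p) w = s * g p (u1 p) w + t * g p (u2 p) w.
    rewrite glin; congr (_ + _).
    have g0 : g p 0 w = 0.
      by rewrite -(subrr (u2 p)) addrC -scaleN1r glin mulN1r addNr.
    by rewrite -[t *: _]addr0 glin g0 addr0.
  have g2 s t s' t' : g p (s *: u1 p + t *: u2 p) (s' *: u1 p + t' *: u2 p) = s * s' + t * t'.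
    rewrite gcomb (gsym _ (u1 p)) (gsym _ (u2 p)) !gcomb (gsym _ (u2 p)) g11 g22 g12.
    by rewrite !mulr1 !mulr0 addr0 add0r.
  have g3 s t : g p (s *: u1 p + t *: u2 p) (delta_mx 0 2) = 0.
    by rewrite gcomb g13 g23 !mulr0 addr0.
  have half : 1 / 2 + 1 / 2 = 1 :> R by field.
  move: i j; do 2!apply: I3_ind; rewrite /e/= ?g2 ?g3 ?g33 ?(gsym _ (delta_mx _ _)) ?g3//.
  + by rewrite r2 half.
  + by rewrite mulrN subrr.
  + by rewrite mulNr subrr.
  + by rewrite mulrNN r2 half.
- move=> p Up; rewrite /e/mu/= /lie_bracket !ab !ruz !scale0r subrr addrC subrr scale0r //.
- move=> p Up; rewrite /e/mu/= /lie_bracket along_cst ab mxE eqxx scale1r.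
  by apply/rowP => k; rewrite /a !mxE; ring.
- move=> p Up; rewrite /e/mu/= /lie_bracket along_cst ab mxE eqxx scale1r.
  by apply/rowP => k; rewrite /b !mxE; ring.
- rewrite /milnor_curv /mu/= mulr0 subr0 addr0 mulNr oppr_eq0 mulf_neq0//.
- rewrite /milnor_curv /mu/= mul0r subr0 add0r mulrN oppr_eq0 mulf_neq0//.
- rewrite /milnor_curv /mu/=.
  have -> : (- c * (c + 0) - c * 0) * (c * (0 - c) - 0 * - c - (0 * (- c + c) - - c * c)) * - c
     + (0 * (- c + c) - - c * c) * (c * (0 - c) - 0 * - c - (- c * (c + 0) - c * 0)) * 0
     = - 2 * c ^+ 5 by ring.
  by rewrite mulf_neq0 ?expf_neq0// oppr_eq0 pnatr_eq0.
Qed.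

End sol_frame.

Theorem sol_not_immersible (R : realType) :
  ~ locally_immersible 4 setT (@Sol_metric R).
Proof.
move=> [U [oU U0 _ [f]]].
apply: (@sol_frame_not_immersible R _ U 1 (delta_mx 0 0) (delta_mx 0 1)) => //.
- by rewrite mxE.
- by rewrite mxE.
- move=> p Up; rewrite /Sol_metric /exp_field !mxE/=.
  have E1 : expR (2 * p 0 2) * (expR (- 1 * p 0 2) * expR (- 1 * p 0 2)) = 1.
    by rewrite -!expRD -[RHS]expR0; congr expR; ring.
  have E2 : expR (- (2 * p 0 2)) * (expR (1 * p 0 2) * expR (1 * p 0 2)) = 1.
    by rewrite -!expRD -[RHS]expR0; congr expR; ring.
  by rewrite !(mulr0, mul0r, mulr1, addr0, add0r) E1 E2.
- by move=> p u v w a; rewrite /Sol_metric !mxE; ring.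
- by move=> p u v; rewrite /Sol_metric; ring.
Qed.

(** * The torus bundles *)

Local Open Scope quotient_scope.

(** Neighbourhoods of a row are generated by products of neighbourhoods of its
    entries, and there are finitely many entries. *)
Lemma continuous_row (R : realType) (T : topologicalType) (m : nat) (f : T -> 'rV[R]_m) :
  (forall a, continuous (fun p => f p 0 a)) -> continuous f.
Proof.
move=> fc p A [P Pp sPA].
have near_all : \forall q \near p, forall a, P 0 a (f q 0 a).
  by apply: filter_forall => a; exact: (fc a p _ (Pp 0 a)).
apply: filterS near_all => q Pq; apply: sPA => i a; rewrite (ord1 i); exact: Pq.
Qed.

Lemma torusB_cover_continuous (R : realType) (B : 'M[int]_2) :
  continuous (@torusB_cover R B).
Proof.
have c_coord (i : 'I_3) : continuous (fun p : 'rV[R]_3 => p 0 i) by exact: coord_continuous.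
have c_row : continuous (fun p : 'rV[R]_3 => \row_(j < 2) [:: p 0 0; p 0 1]`_j).
  by apply: continuous_row => -[[|[|//]] a]; under eq_fun do rewrite mxE; exact: c_coord.
move=> p; apply: (@continuous_comp _ _ _
  (fun p : 'rV[R]_3 => (\pi_(torus2 R) (\row_(j < 2) [:: p 0 0; p 0 1]`_j), p 0 2))
  (\pi_(torusB R B))); last exact: pi_continuous.
have c_pi : {for p, continuous
    (fun p : 'rV[R]_3 => \pi_(torus2 R) (\row_(j < 2) [:: p 0 0; p 0 1]`_j))}.
  apply: (@continuous_comp _ _ _ _ (\pi_(torus2 R))); first exact: c_row.
  exact: pi_continuous.
exact: (cvg_pair c_pi (c_coord 2 p)).
Qed.

Lemma torusB_cover_surjective (R : realType) (B : 'M[int]_2) (y : torusB R B) :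
  exists p, torusB_cover B p = y.
Proof.
pose t : torus2 R := (repr y).1; pose w : 'rV[R]_2 := repr t.
exists (\row_(j < 3) [:: w 0 0; w 0 1; (repr y).2]`_j).
rewrite /torusB_cover !mxE /=.
have -> : \row_(j < 2) [:: w 0 0; w 0 1]`_j = w.
  by apply/rowP => -[[|[|//]] a]; rewrite mxE /=; congr (w 0 _); apply/val_inj.
by rewrite /w reprK /t -surjective_pairing reprK.
Qed.

(** Eigenvectors for distinct eigenvalues are independent: B is applied to a
    vanishing combination of v1 and v2. *)
Lemma torusB_frame_unit (R : realType) (B : 'M[int]_2) (alpha : R) (v1 v2 : 'rV[R]_2) p :
  0 < alpha -> alpha != alpha^-1 ->
  v1 != 0 -> lin_act B v1 = alpha^-1 *: v1 ->
  v2 != 0 -> lin_act B v2 = alpha *: v2 ->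
  (\matrix_(i < 3) torusB_frame alpha v1 v2 p i) \in unitmx.
Proof.
move=> a0 aV v10 Bv1 v20 Bv2; rewrite -row_free_unit; apply: inj_row_free => w.
rewrite mulmx_sum_row sum_I3 !rowK /torusB_frame/=.
set x := alpha `^ _; set y := alpha `^ _ => w0.
have x0 : x != 0 by rewrite lt0r_neq0// powR_gt0.
have y0 : y != 0 by rewrite lt0r_neq0// powR_gt0.
have comp k : w 0 0 * x * horizontal v1 0 k + w 0 1 * y * horizontal v2 0 k
    + w 0 2 * [:: 0; 0; 1]`_k = 0.
  by have /rowP/(_ k) := w0; rewrite !mxE !mulrA.
have w2 : w 0 2 = 0.
  by have := comp 2; rewrite !mxE/= !mulr0 !add0r mulr1.
have comb : (w 0 0 * x) *: v1 + (w 0 1 * y) *: v2 = 0.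
  apply/rowP => -[[|[|//]] k]; rewrite !mxE.
    have := comp 0; rewrite !mxE/= w2 mul0r addr0 => <-.
    by congr (_ * v1 0 _ + _ * v2 0 _); apply/val_inj.
  have := comp 1; rewrite !mxE/= w2 mul0r addr0 => <-.
  by congr (_ * v1 0 _ + _ * v2 0 _); apply/val_inj.
(* the image of comb by B, in which the coefficients are scaled by the
   eigenvalues *)
have combB : (w 0 0 * x / alpha) *: v1 + (w 0 1 * y * alpha) *: v2 = 0.
  have := congr1 (lin_act B) comb.
  rewrite /lin_act mul0mx mulmxDl -!scalemxAl.
  by move: Bv1 Bv2; rewrite /lin_act => -> ->; rewrite !scalerA.
have aa : alpha - alpha^-1 != 0 by rewrite subr_eq0.
have w1 : w 0 1 = 0.
  have : (w 0 1 * y * (alpha - alpha^-1)) *: v2 = 0.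
    rewrite mulrBr scalerBl -[RHS](subr0 0) -{1}combB.
    rewrite -(scaler0 _ (alpha^-1)) -{1}comb scalerDr !scalerA.
    by rewrite opprD addrACA (mulrC alpha^-1) subrr add0r (mulrC alpha^-1).
  move/eqP; rewrite scaler_eq0 (negPf v20) orbF.
  by rewrite !mulf_eq0 (negPf y0) (negPf aa) !orbF => /eqP.
have w00 : w 0 0 = 0.
  move: comb => /eqP; rewrite w1 mul0r scale0r addr0 scaler_eq0 (negPf v10) orbF.
  by rewrite mulf_eq0 (negPf x0) orbF => /eqP.
by apply/rowP; apply: I3_ind; rewrite mxE.
Qed.

Theorem torusB_not_immersible (R : realType) (B : 'M[int]_2) (alpha : R) (v1 v2 : 'rV[R]_2) :
  0 < alpha -> alpha != alpha^-1 ->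
  v1 != 0 -> lin_act B v1 = alpha^-1 *: v1 ->
  v2 != 0 -> lin_act B v2 = alpha *: v2 ->
  ~ torusB_locally_immersible 4 B alpha v1 v2.
Proof.
move=> a0 aV v10 Bv1 v20 Bv2 [T [oT [y Ty] [f]]].
set g := frame_metric _.
have orth p (i j : 'I_3) :
    g p (torusB_frame alpha v1 v2 p i) (torusB_frame alpha v1 v2 p j) = (i == j)%:R.
  have Au := torusB_frame_unit p a0 aV v10 Bv1 v20 Bv2.
  rewrite /g /frame_metric; set A := \matrix_(k < 3) _.
  have rowA k : torusB_frame alpha v1 v2 p k *m invmx A = delta_mx 0 k.
    rewrite -(rowK (torusB_frame alpha v1 v2 p)) -/A -row_mul mulmxV// rowE mulmx1.
    by [].
  rewrite !rowA /dot (bigD1 i)//= !mxE !eqxx mul1r big1 ?addr0// => k ki.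
  by rewrite !mxE (negPf ki) andbF mul0r.
have exp1 p : torusB_frame alpha v1 v2 p 0 = exp_field (- ln alpha) (horizontal v1) p.
  by rewrite /torusB_frame/= /exp_field /powR gt_eqF// mulrC mulrN mulNr.
have exp2 p : torusB_frame alpha v1 v2 p 1 = exp_field (ln alpha) (horizontal v2) p.
  by rewrite /torusB_frame/= /exp_field /powR gt_eqF// mulrC.
have exp3 p : torusB_frame alpha v1 v2 p 2 = delta_mx 0 2.
  by apply/rowP; apply: I3_ind; rewrite !mxE.
apply: (@sol_frame_not_immersible R _ _ (ln alpha) (horizontal v1) (horizontal v2)).
- by apply: open_comp => // p _; exact: torusB_cover_continuous.
- by have [p py] := torusB_cover_surjective y; exists p; rewrite /= py.
- by rewrite ln_eq0//; apply: contra_neq aV => ->; rewrite invr1.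
- by rewrite mxE.
- by rewrite mxE.
- by move=> p _ /=; rewrite -exp1 -exp2 -(exp3 p) !orth.
- move=> p u v w a; rewrite /g /frame_metric mulmxDl -scalemxAl dotDl dotZl//.
- by move=> p u v; rewrite /g /frame_metric dotC.
Qed.

Local Close Scope quotient_scope.

(** * The coordinate models of E(kappa, tau) *)

Definition row3 (R : realType) (a b c : R) : 'rV[R]_3 := \row_(j < 3) [:: a; b; c]`_j.

Lemma along_row3 (R : realType) (n : nat) (f0 f1 f2 : 'rV[R]_n -> R) (d0 d1 d2 : R) X p :
  is_derive p (X p) f0 d0 -> is_derive p (X p) f1 d1 -> is_derive p (X p) f2 d2 ->
  along X (fun q => row3 (f0 q) (f1 q) (f2 q)) p = row3 d0 d1 d2.
Proof.
move=> [_ D0] [_ D1] [_ D2]; apply/rowP => a; rewrite alongE mxE.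
under eq_fun do rewrite mxE.
by move: a; apply: I3_ind.
Qed.

Lemma Ck_row3 (R : realType) (n k : nat) (U : set 'rV[R]_n) (f0 f1 f2 : 'rV[R]_n -> R) :
  Ck_on k U f0 -> Ck_on k U f1 -> Ck_on k U f2 ->
  Ck_row k U (fun q => row3 (f0 q) (f1 q) (f2 q)).
Proof.
by move=> C0 C1 C2; apply: I3_ind; under eq_fun do rewrite mxE.
Qed.

Section E_frame.
Context {R : realType}.
Variables kappa tau : R.
Notation V := 'rV[R]_3.
Notation s := (kappa / (2 * tau)).

(** E_e1, E_e2, E_e3 is the frame obtained from the horizontal lifts of the
    conformal frame of the base by a rotation of angle s z along the fibre; the
    rotation is what makes the structure constants constant when kappa is
    nonzero. *)
Definition E_e1 (p : V) : V :=
  row3 (E_conf kappa p * cos (s * p 0 2)) (E_conf kappa p * sin (s * p 0 2))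
    (tau * (p 0 0 * sin (s * p 0 2) - p 0 1 * cos (s * p 0 2))).

Definition E_e2 (p : V) : V :=
  row3 (- (E_conf kappa p * sin (s * p 0 2))) (E_conf kappa p * cos (s * p 0 2))
    (tau * (p 0 1 * sin (s * p 0 2) + p 0 0 * cos (s * p 0 2))).

Definition E_e3 (p : V) : V := row3 0 0 1.

Lemma Ck_E_conf k U : open U -> Ck_on k U (E_conf kappa).
Proof.
move=> oU; have Cx i := Ck_on_coord k U (i : 'I_3).
apply: (Ck_onD oU); first exact: Ck_on_cst.
apply: (Ck_onM oU); first exact: Ck_on_cst.
by apply: (Ck_onD oU); rewrite /GRing.exp/=; apply: (Ck_onM oU).
Qed.

Lemma Ck_E_e1 k U : open U -> Ck_row k U E_e1.
Proof.
move=> oU; have Cx i := Ck_on_coord k U (i : 'I_3); have Cc := Ck_E_conf k oU.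
have [Ccos Csin] := Ck_on_cos_sin oU k s 2.
apply: Ck_row3; [exact: Ck_onM|exact: Ck_onM|].
apply: (Ck_onM oU); first exact: Ck_on_cst.
apply: (Ck_onD oU); first exact: Ck_onM.
have := Ck_onM oU (Ck_on_cst k U (-1 : R)) (Ck_onM oU (Cx 1) Ccos).
by apply: Ck_on_ext => // p _; rewrite mulN1r.
Qed.

Lemma Ck_E_e2 k U : open U -> Ck_row k U E_e2.
Proof.
move=> oU; have Cx i := Ck_on_coord k U (i : 'I_3); have Cc := Ck_E_conf k oU.
have [Ccos Csin] := Ck_on_cos_sin oU k s 2.
apply: Ck_row3; [|exact: Ck_onM|].
  have := Ck_onM oU (Ck_on_cst k U (-1 : R)) (Ck_onM oU Cc Csin).
  by apply: Ck_on_ext => // p _; rewrite mulN1r.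
apply: (Ck_onM oU); first exact: Ck_on_cst.
by apply: (Ck_onD oU); exact: Ck_onM.
Qed.

Lemma is_derive_E_conf (p v : V) :
  is_derive p v (E_conf kappa) (kappa / 2 * (p 0 0 * v 0 0 + p 0 1 * v 0 1)).
Proof.
have dx i := is_derive_coord p v i.
apply: (is_derive_eq (is_deriveD (is_derive_cst (1 : R) p v)
  (is_deriveM (is_derive_cst (kappa / 4) p v)
    (is_deriveD (is_deriveM (dx 0) (dx 0)) (is_deriveM (dx 1) (dx 1)))))).
by rewrite /GRing.scale/=; field.
Qed.

Lemma along_E_e1 (X : V -> V) (p : V) :
  let v := X p in let x := p 0 0 in let y := p 0 1 in
  let C := cos (s * p 0 2) in let S := sin (s * p 0 2) in
  let dconf := kappa / 2 * (x * v 0 0 + y * v 0 1) in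
  along X E_e1 p =
  row3 (dconf * C - E_conf kappa p * (s * v 0 2 * S))
       (dconf * S + E_conf kappa p * (s * v 0 2 * C))
       (tau * (v 0 0 * S + x * (s * v 0 2 * C) - (v 0 1 * C - y * (s * v 0 2 * S)))).
Proof.
move=> v x y C S dconf.
have dC := is_derive_scaled_coord v (is_derive_cos (s * p 0 2)).
have dS := is_derive_scaled_coord v (is_derive_sin (s * p 0 2)).
have dx i := is_derive_coord p v i.
have dc := is_derive_E_conf p v.
apply: along_row3.
- apply: (is_derive_eq (is_deriveM dc dC)).
  by rewrite /GRing.scale/= -/C -/S -/x -/y -/dconf; ring.
- apply: (is_derive_eq (is_deriveM dc dS)).
  by rewrite /GRing.scale/= -/C -/S -/x -/y -/dconf; ring.
- apply: (is_derive_eq (is_deriveM (is_derive_cst tau p v)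
    (is_deriveB (is_deriveM (dx 0) dS) (is_deriveM (dx 1) dC)))).
  by rewrite /GRing.scale/= -/C -/S -/x -/y; ring.
Qed.

Lemma along_E_e2 (X : V -> V) (p : V) :
  let v := X p in let x := p 0 0 in let y := p 0 1 in
  let C := cos (s * p 0 2) in let S := sin (s * p 0 2) in
  let dconf := kappa / 2 * (x * v 0 0 + y * v 0 1) in
  along X E_e2 p =
  row3 (- (dconf * S + E_conf kappa p * (s * v 0 2 * C)))
       (dconf * C - E_conf kappa p * (s * v 0 2 * S))
       (tau * (v 0 1 * S + y * (s * v 0 2 * C) + (v 0 0 * C - x * (s * v 0 2 * S)))).
Proof.
move=> v x y C S dconf.
have dC := is_derive_scaled_coord v (is_derive_cos (s * p 0 2)).
have dS := is_derive_scaled_coord v (is_derive_sin (s * p 0 2)).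
have dx i := is_derive_coord p v i.
have dc := is_derive_E_conf p v.
apply: along_row3.
- apply: (is_derive_eq (is_deriveN (is_deriveM dc dS))).
  by rewrite /GRing.scale/= -/C -/S -/x -/y -/dconf; ring.
- apply: (is_derive_eq (is_deriveM dc dC)).
  by rewrite /GRing.scale/= -/C -/S -/x -/y -/dconf; ring.
- apply: (is_derive_eq (is_deriveM (is_derive_cst tau p v)
    (is_deriveD (is_deriveM (dx 1) dS) (is_deriveM (dx 0) dC)))).
  by rewrite /GRing.scale/= -/C -/S -/x -/y; ring.
Qed.

Hypothesis tau0 : tau != 0.

Definition E_mu (i : 'I_3) : R := if i == 2 then s - tau else tau.

Lemma E_curv0 : milnor_curv E_mu 0 1 2 = tau ^+ 2.
Proof. by rewrite /milnor_curv /E_mu/=; ring. Qed.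

Lemma E_curv1 : milnor_curv E_mu 1 2 0 = tau ^+ 2.
Proof. by rewrite /milnor_curv /E_mu/=; ring. Qed.

Lemma E_curv2 : milnor_curv E_mu 2 0 1 = kappa - 3 * tau ^+ 2.
Proof. by rewrite /milnor_curv /E_mu/=; field. Qed.

Lemma E_codazzi : kappa != 4 * tau ^+ 2 ->
  milnor_curv E_mu 0 1 2 * (milnor_curv E_mu 1 2 0 - milnor_curv E_mu 2 0 1) * E_mu 0
  + milnor_curv E_mu 2 0 1 * (milnor_curv E_mu 1 2 0 - milnor_curv E_mu 0 1 2) * E_mu 2
    != 0.
Proof.
move=> kt; rewrite E_curv0 E_curv1 E_curv2 (_ : E_mu 0 = tau)//.
rewrite (_ : _ + _ = tau ^+ 3 * (4 * tau ^+ 2 - kappa)); last by ring.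
by rewrite mulf_neq0 ?expf_neq0// subr_eq0 eq_sym.
Qed.

Lemma bracket_E_e12 p : lie_bracket E_e1 E_e2 p = (2 * tau) *: E_e3 p.
Proof.
rewrite /lie_bracket along_E_e1 along_E_e2 /E_e1 /E_e2.
have E := cos2Dsin2 (s * p 0 2); move: (cos _) (sin _) E => C S CS.
apply/rowP; apply: I3_ind; rewrite !mxE /E_conf /=.
- by field.
- by field.
- by transitivity ((C ^+ 2 + S ^+ 2) * (2 * tau)); [field|rewrite CS mul1r mulr1].
Qed.

Lemma bracket_E_e23 p : lie_bracket E_e2 E_e3 p = s *: E_e1 p.
Proof.
rewrite /lie_bracket along_cst along_E_e2 /E_e1 /E_e2.
move: (cos _) (sin _) => C S.
by apply/rowP; apply: I3_ind; rewrite !mxE /E_conf /=; ring.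
Qed.

Lemma bracket_E_e31 p : lie_bracket E_e3 E_e1 p = s *: E_e2 p.
Proof.
rewrite /lie_bracket along_cst along_E_e1 /E_e1 /E_e2.
move: (cos _) (sin _) => C S.
by apply/rowP; apply: I3_ind; rewrite !mxE /E_conf /=; ring.
Qed.

Theorem E_not_immersible : kappa != 4 * tau ^+ 2 ->
  ~ locally_immersible 4 (E_domain kappa) (E_metric kappa tau).
Proof.
move=> kt [U [oU U0 UE [f]]].
pose e (i : 'I_3) := if i == 0 then E_e1 else if i == 1 then E_e2 else E_e3.
apply: (@milnor_frame_not_immersible R 3 _ U e E_mu) => //.
- apply: I3_ind; [exact: Ck_E_e1|exact: Ck_E_e2|].
  by apply: Ck_row3; exact: Ck_on_cst.
- move=> i j p /UE; rewrite /E_domain/= => /lt0r_neq0 conf0.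
  have CS := cos2Dsin2 (s * p 0 2).
  have g_comm u v : E_metric kappa tau p u v = E_metric kappa tau p v u.
    by rewrite /E_metric; ring.
  have h11 : E_metric kappa tau p (E_e1 p) (E_e1 p) = 1.
    rewrite /E_metric /E_e1 !mxE/=.
    move: (cos _) (sin _) (E_conf kappa p) conf0 CS => C S c c0 CS.
    by rewrite -CS; field.
  have h12 : E_metric kappa tau p (E_e1 p) (E_e2 p) = 0.
    rewrite /E_metric /E_e1 /E_e2 !mxE/=.
    move: (cos _) (sin _) (E_conf kappa p) conf0 CS => C S c c0 CS.
    by field.
  have h22 : E_metric kappa tau p (E_e2 p) (E_e2 p) = 1.
    rewrite /E_metric /E_e2 !mxE/=.
    move: (cos _) (sin _) (E_conf kappa p) conf0 CS => C S c c0 CS.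
    by rewrite -CS; field.
  have h13 : E_metric kappa tau p (E_e1 p) (E_e3 p) = 0.
    rewrite /E_metric /E_e1 !mxE/=.
    move: (cos _) (sin _) (E_conf kappa p) conf0 CS => C S c c0 CS.
    by field.
  have h23 : E_metric kappa tau p (E_e2 p) (E_e3 p) = 0.
    rewrite /E_metric /E_e2 !mxE/=.
    move: (cos _) (sin _) (E_conf kappa p) conf0 CS => C S c c0 CS.
    by field.
  have h33 : E_metric kappa tau p (E_e3 p) (E_e3 p) = 1.
    by rewrite /E_metric !mxE/=; ring.
  by move: i j; do 2!apply: I3_ind => //=; rewrite g_comm.
- by move=> p _; rewrite /e /E_mu/= bracket_E_e12; congr (_ *: _); ring.
- by move=> p _; rewrite /e /E_mu/= bracket_E_e23 addrC subrK.
- by move=> p _; rewrite /e /E_mu/= bracket_E_e31 subrK.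
- by rewrite E_curv0 expf_neq0.
- by rewrite E_curv1 expf_neq0.
- exact: E_codazzi.
Qed.

End E_frame.

(** * Berger spheres *)

(** A tangent vector of the sphere is the velocity of a great circle, along which
    g vanishes. The scalar a serves to apply this to multiples of unit vectors. *)
Lemma sphere_tangent_derive (R : realType) (U : set 'rV[R]_4) (g : 'rV[R]_4 -> R)
    (p w : 'rV[R]_4) (a : R) :
  open U -> U p -> sphere3 p -> dot p w = 0 -> dot w w = 1 -> differentiable g p ->
  (forall q, U q -> sphere3 q -> g q = 0) -> 'D_(a *: w) g p = 0.
Proof.
move=> oU Up Sp pw ww dg g0.
pose c (t : R) : 'rV[R]_4 := cos t *: p + sin t *: w.
have c0 : c 0 = p by rewrite /c cos0 sin0 scale0r scale1r addr0.
have dc : differentiable c 0.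
  apply: differentiableD; apply: differentiableZl; apply/derivable1_diffP.
    exact: derivable_cos.
  exact: derivable_sin.
have Dc : 'D_1 c 0 = w.
  apply/rowP => b; rewrite -derive_component// /c.
  under eq_fun do rewrite !mxE.
  have [_ ->] : is_derive (0 : R) 1 (fun t => cos t * p 0 b + sin t * w 0 b) (w 0 b).
    apply: (is_derive_eq (is_deriveD (is_deriveM (is_derive_cos 0) (is_derive_cst (p 0 b) _ _))
      (is_deriveM (is_derive_sin 0) (is_derive_cst (w 0 b) _ _)))).
    by rewrite /GRing.scale/= cos0 sin0; ring.
  by [].
have c_sphere t : sphere3 (c t).
  rewrite /sphere3/= /c !(dotDl, dotDr, dotZl, dotZr) (dotC w p) pw ww Sp.
  by rewrite !(mulr0, mulr1) addr0 add0r -!expr2 cos2Dsin2.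
have dg0 : differentiable g (c 0) by rewrite c0.
have -> : 'D_(a *: w) g p = a *: 'D_1 (g \o c) 0.
  have gw : 'D_w g (c 0) = 'd g (c 0) ('d c 0 1).
    by rewrite (deriveE w dg0) -(deriveE (1 : R) dc) Dc.
  have gc : 'D_1 (g \o c) 0 = 'd g (c 0) ('d c 0 1).
    by rewrite (deriveE (1 : R) (differentiable_comp dc dg0)) (diff_comp dc dg0).
  by rewrite gc -gw c0 (deriveE _ dg) linearZ/= (deriveE _ dg).
have nU : nbhs (c 0) U by rewrite c0; apply: open_nbhs_nbhs.
have gc0 : \forall t \near (0 : R), (g \o c) t = cst 0 t.
  have cU : \forall t \near (0 : R), U (c t).
    have cc : {for 0, continuous c} by exact: differentiable_continuous.
    exact: (cc U nU).
  apply: filterS cU => t Ut /=; exact: g0.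
by rewrite (near_eq_derive _ gc0) derive_cst scaler0.
Qed.

Section quaternions.
Context {R : realType}.
Notation H := 'rV[R]_4.
Implicit Types (p : H) (X : H -> H).

(** Left multiplications by the quaternions j and k, compatible with [mul_i] when
    a row is read as x_0 + x_1 i + x_2 j + x_3 k. *)
Definition mul_j p : H := \row_(b < 4) [:: - p 0 2; p 0 3; p 0 0; - p 0 1]`_b.
Definition mul_k p : H := \row_(b < 4) [:: - p 0 3; - p 0 2; p 0 1; p 0 0]`_b.

Lemma along_row4 (f0 f1 f2 f3 : H -> R) (d0 d1 d2 d3 : R) X p :
  is_derive p (X p) f0 d0 -> is_derive p (X p) f1 d1 ->
  is_derive p (X p) f2 d2 -> is_derive p (X p) f3 d3 ->
  along X (fun q => \row_(b < 4) [:: f0 q; f1 q; f2 q; f3 q]`_b) p =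
  \row_(b < 4) [:: d0; d1; d2; d3]`_b.
Proof.
move=> [_ D0] [_ D1] [_ D2] [_ D3]; apply/rowP => a; rewrite alongE mxE.
under eq_fun do rewrite mxE.
by move: a; apply: I4_ind.
Qed.

Lemma along_mul X p :
  [/\ along X (@mul_i R) p = mul_i (X p), along X mul_j p = mul_j (X p) &
      along X mul_k p = mul_k (X p)].
Proof.
have dx := is_derive_coord p (X p).
by split; apply: along_row4; (exact: dx || exact: (is_deriveN (dx _))).
Qed.

Lemma Ck_mul k U : open U ->
  [/\ Ck_row k U (@mul_i R), Ck_row k U mul_j & Ck_row k U mul_k].
Proof.
move=> oU; have Cx b := Ck_on_coord k U (b : 'I_4).
have CN b : Ck_on k U (fun q : H => - q 0 b).
  apply: (Ck_on_ext oU) (Ck_onM oU (Ck_on_cst k U (-1 : R)) (Cx b)) => p _.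
  by rewrite mulN1r.
by split; apply: I4_ind; under eq_fun do rewrite mxE/=.
Qed.

Lemma dot_mul p :
  [/\ dot p (mul_i p) = 0, dot p (mul_j p) = 0 & dot p (mul_k p) = 0] /\
  [/\ dot (mul_i p) (mul_i p) = dot p p, dot (mul_j p) (mul_j p) = dot p p &
      dot (mul_k p) (mul_k p) = dot p p] /\
  [/\ dot (mul_i p) (mul_j p) = 0, dot (mul_j p) (mul_k p) = 0 &
      dot (mul_k p) (mul_i p) = 0].
Proof. by split; last split; split; rewrite !dot4 !mxE/=; ring. Qed.

Lemma mulZ (b : R) p :
  [/\ mul_i (b *: p) = b *: mul_i p, mul_j (b *: p) = b *: mul_j p &
      mul_k (b *: p) = b *: mul_k p].
Proof. by split; apply/rowP; apply: I4_ind; rewrite !mxE/= ?mulrN. Qed.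

(** As [X, Y] = DY X - DX Y, the bracket of two linear fields is the opposite of
    the commutator of their matrices, whence the sign - 2. *)
Lemma mul_commutator p :
  [/\ mul_k (mul_j p) - mul_j (mul_k p) = - 2 *: mul_i p,
      mul_i (mul_k p) - mul_k (mul_i p) = - 2 *: mul_j p &
      mul_j (mul_i p) - mul_i (mul_j p) = - 2 *: mul_k p].
Proof. by split; apply/rowP; apply: I4_ind; rewrite !mxE/=; ring. Qed.

End quaternions.

(** The frame is (sqrt kappa / 2) jx, (sqrt kappa / 2) kx, - (kappa / (4 tau)) ix;
    the sign of the last field is the one for which it has the same brackets as
    the frame of E(kappa, tau). The smooth extensions of f differ from point to
    point: one of them, F, is fixed around a point p0, and at the other points p
    the extension G given there has the same derivatives as F along the sphere. *)
Theorem Berger_not_immersible (R : realType) (kappa tau : R) :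
  0 < kappa -> tau != 0 -> kappa != 4 * tau ^+ 2 ->
  ~ sub_locally_immersible 4 (@sphere3 R) (@sphere3_tangent R) (Berger_metric kappa tau).
Proof.
move=> k0 tau0 kt [U [oU [p0 [Up0 Sp0]] [f isof]]].
have [W [F [oW Wp0 sF Ff _]]] := isof p0 (conj Up0 Sp0).
pose M := (W `&` U) `&` @sphere3 R.
pose r : R := Num.sqrt kappa / 2; pose t : R := - (kappa / (4 * tau)).
have r2 : r * r = kappa / 4.
  rewrite /r mulrACA -expr2 sqr_sqrtr ?ltW//; congr (_ * _); by field.
have kn0 : kappa != 0 by rewrite lt0r_neq0.
pose a (i : 'I_3) := if i == 2 then t else r.
pose m (i : 'I_3) := if i == 0 then @mul_j R else if i == 1 then @mul_k R else @mul_i R.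
pose e (i : 'I_3) p := a i *: m i p.
have MW : M `<=` W by move=> p [[]].
have m_unit i p : sphere3 p -> dot p (m i p) = 0 /\ dot (m i p) (m i p) = 1.
  move=> Sp; have [[pi pj pk] [[ii jj kk] _]] := dot_mul p.
  by move: i; apply: I3_ind; rewrite /m/= ?pi ?pj ?pk ?ii ?jj ?kk.
have Cm i : Ck_row 2 W (m i).
  by have [Ci Cj Ck] := Ck_mul 2 oW; move: i; apply: I3_ind; [exact: Cj|exact: Ck|exact: Ci].
have oWU : open (W `&` U) by exact: openI.
have tgt i : tangent_field M (e i).
  move=> g p [WUp Sp] dg g0; have [pm mm] := m_unit i p Sp.
  by apply: (sphere_tangent_derive _ oWU) => // q WUq Sq; exact: g0.
have brk i j p : lie_bracket (e i) (e j) p = (a i * a j) *: (m j (m i p) - m i (m j p)).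
  have alm k X : along X (m k) p = m k (X p).
    have [Ai Aj Ak] := along_mul X p; move: k.
    by apply: I3_ind; [exact: Aj|exact: Ak|exact: Ai].
  have mZ k b q : m k (b *: q) = b *: m k q.
    have [Zi Zj Zk] := mulZ b q; move: k.
    by apply: I3_ind; [exact: Zj|exact: Zk|exact: Zi].
  have dm k : diff_row (m k) p.
    apply: (Ck_row_diff (k := 0) (U := setT)) => //.
    have [Ci Cj Ck] := Ck_mul 1 (@openT 'rV[R]_4).
    by move: k; apply: I3_ind; [exact: Cj|exact: Ck|exact: Ci].
  rewrite /lie_bracket /e !alongZ// !alm !mZ !scalerA (mulrC (a j)).
  by rewrite scalerBr.
have metric_e i j p : sphere3 p ->
    Berger_metric kappa tau p (e i p) (e j p) = (i == j)%:R.
  move=> Sp; have [_ [[ii jj kk] [ij jk ki]]] := dot_mul p.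
  have Spp : dot p p = 1 by [].
  rewrite /Berger_metric /e !(dotZl, dotZr).
  move: i j; do 2!apply: I3_ind; rewrite /m/=.
  all: rewrite ?(dotC (mul_j p) (mul_i p)) ?(dotC (mul_i p) (mul_k p))
    ?(dotC (mul_k p) (mul_j p)).
  all: rewrite ?ii ?jj ?kk ?ij ?jk ?ki ?Spp ?mulr0 ?mul0r ?addr0 ?mulr0 //.
  - by rewrite (_ : a 0 = r)// mulr1 r2; field.
  - by rewrite (_ : a 1 = r)// mulr1 r2; field.
  - by rewrite (_ : a 2 = t)// /t; field; rewrite tau0 kn0.
have Ce i : Ck_row 2 W (e i) by exact: Ck_rowZ.
refine (@milnor_frame_not_immersed R 4 W M e F (E_mu kappa tau) oW MW Ce
  (smooth_Ck_row 3 oW sF) tgt _ _ _ _ _ _ _ _).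
- move=> i j p Mp; have [[Wp Up] Sp] := Mp.
  have [W' [G [oW' W'p sG Gf isoG]]] := isof p (conj Up Sp).
  have dF : differentiable F p by have [dF _] := sF 1%N; exact: dF.
  have dG : differentiable G p by have [dG _] := sG 1%N; exact: dG.
  have FG k : along (e k) F p = 'd G p (e k p).
    rewrite -along_diff//; apply/rowP => b; rewrite !alongE; apply/eqP; rewrite -subr_eq0.
    have dFb := differentiable_component b dF; have dGb := differentiable_component b dG.
    rewrite -deriveB; [|exact: diff_derivable..]; apply/eqP.
    have [pm mm] := m_unit k p Sp.
    apply: (sphere_tangent_derive (U := (W `&` U) `&` W')) => //.
    + exact: openI.
    + exact: differentiableB.
    + move=> q [[Wq Uq] W'q] Sq; rewrite -[_ q]/(F q 0 b - G q 0 b).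
      by rewrite Ff// Gf// subrr.
  have e_tangent k : sphere3_tangent p (e k p).
    by rewrite /sphere3_tangent/= /e dotZr (m_unit k p Sp).1 mulr0.
  by rewrite !FG isoG// metric_e.
- move=> p _; rewrite brk; have [E1 _ _] := mul_commutator p.
  rewrite [X in _ *: X]E1 /e [m 2 p]/(mul_i p) !scalerA; congr (_ *: _).
  rewrite (_ : a 0 = r)// (_ : a 1 = r)// r2 /E_mu/= (_ : a 2 = t)// /t; field.
  by rewrite tau0.
- move=> p _; rewrite brk; have [_ E2 _] := mul_commutator p.
  rewrite [X in _ *: X]E2 /e [m 0 p]/(mul_j p) !scalerA; congr (_ *: _).
  rewrite (_ : a 0 = r)// (_ : a 1 = r)// /E_mu/= (_ : a 2 = t)// /t; field.
  by rewrite tau0.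
- move=> p _; rewrite brk; have [_ _ E3] := mul_commutator p.
  rewrite [X in _ *: X]E3 /e [m 1 p]/(mul_k p) !scalerA; congr (_ *: _).
  rewrite (_ : a 0 = r)// (_ : a 1 = r)// /E_mu/= (_ : a 2 = t)// /t; field.
  by rewrite tau0.
- by exists p0.
- by rewrite E_curv0 expf_neq0.
- by rewrite E_curv1 expf_neq0.
- exact: E_codazzi.
Qed.

(** * The theorem *)

Theorem proposition5p1 (R : realType) :
  [/\ (* Nil_3 *)
      forall tau : R, tau != 0 ->
        ~ locally_immersible 4 (E_domain 0) (E_metric 0 tau),
      (* Sol_3 *)
      ~ locally_immersible 4 setT (@Sol_metric R),
      (* the universal cover of PSL_2(R) *)
      forall kappa tau : R, kappa < 0 -> tau != 0 ->
        ~ locally_immersible 4 (E_domain kappa) (E_metric kappa tau),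
      (* Berger spheres *)
      forall kappa tau : R, 0 < kappa -> tau != 0 -> kappa != 4 * tau ^+ 2 ->
        ~ sub_locally_immersible 4 (@sphere3 R) (@sphere3_tangent R)
            (Berger_metric kappa tau)
    & (* T^3_B *)
      forall (B : 'M[int]_2) (alpha : R) (v1 v2 : 'rV[R]_2),
        \det B = 1 -> 0 < alpha -> alpha != alpha^-1 ->
        v1 != 0 -> lin_act B v1 = alpha^-1 *: v1 ->
        v2 != 0 -> lin_act B v2 = alpha *: v2 ->
        ~ torusB_locally_immersible 4 B alpha v1 v2].
Proof.
split.
- move=> tau tau0; apply: E_not_immersible => //.
  by rewrite eq_sym mulf_neq0 ?expf_neq0// pnatr_eq0.
- exact: sol_not_immersible.
- move=> kappa tau k0 tau0; apply: E_not_immersible => //.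
  by rewrite lt_eqF// (lt_le_trans k0)// mulr_ge0// sqr_ge0.
- exact: Berger_not_immersible.
- by move=> B alpha v1 v2 _; exact: torusB_not_immersible.
Qed.
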